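(* Let $n\ge 2$ and let $A_{2n}=\langle a,b\mid (ab)^n=(ba)^n\rangle$ be an even dihedral Artin group, with $\Delta_{ab}=(ab)^n$. The fixed subgroups of each automorphism in $\mathrm{Aut}_\Gamma(A_{2n})$ are determined as follows, where $g\in A_{2n}$. 1. If $\varphi_g$ is of finite order, then $\mathrm{Fix}(\varphi_g)\cong\mathbb{Z}$ with $\langle g\rangle\le_{f.i.}\mathrm{Fix}(\varphi_g)$. Moreover $\langle\Delta_{ab}\rangle\le_{f.i.}\mathrm{Fix}(\varphi_g)$. 2. If $\varphi_g$ is of infinite order, then $\mathrm{Fix}(\varphi_g)\cong\mathbb{Z}^2$ with $\langle g\rangle\times\langle\Delta_{ab}\rangle\le_{f.i.}\mathrm{Fix}(\varphi_g)$. 3. If $\varphi_g\iota$ is of finite order, then $\mathrm{Fix}(\varphi_g\iota)=\{1\}$. 4. If $\varphi_g\iota$ is of infinite order, then $\mathrm{Fix}(\varphi_g\iota)\cong\mathbb{Z}$ with $\langle g\,\iota(g)\rangle\le_{f.i.}\mathrm{Fix}(\varphi_g\iota)$. 5. If $\varphi_g\sigma$ is of finite order, then $\mathrm{Fix}(\varphi_g\sigma)\cong\mathbb{Z}$. Moreover, restricting to the case $g=1$, $\mathrm{Fix}(\sigma)=\langle\Delta_{ab}\rangle$. 6. If $\varphi_g\sigma$ is of infinite order, then $\mathrm{Fix}(\varphi_g\sigma)\cong\mathbb{Z}^2$ with $\langle g\,\sigma(g)\rangle\times\langle\Delta_{ab}\rangle\le_{f.i.}\mathrm{Fix}(\varphi_g\sigma)$.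 7. If $\varphi_g\sigma\iota$ is of finite order, then $\mathrm{Fix}(\varphi_g\sigma\iota)\cong\mathbb{Z}$. Moreover, restricting to the case $g=1$: for $n$ even, $\mathrm{Fix}(\sigma\iota)=\langle(ab)^{\frac n2}(ba)^{-\frac n2}\rangle$; for $n$ odd, $\mathrm{Fix}(\sigma\iota)=\langle b(ab)^{\frac{n-1}2}(ba)^{-\frac{n-1}2}a^{-1}\rangle$. 8. If $\varphi_g\sigma\iota$ is of infinite order, then $\mathrm{Fix}(\varphi_g\sigma\iota)\cong\mathbb{Z}$ with $\langle g\,(\sigma\iota)(g)\rangle\le_{f.i.}\mathrm{Fix}(\varphi_g\sigma\iota)$.
   Context: $\varphi_g$ denotes the inner automorphism $h\mapsto ghg^{-1}$; $\sigma$ is the automorphism exchanging $a$ and $b$; $\iota$ is the automorphism $a\mapsto a^{-1}$, $b\mapsto b^{-1}$ (it commutes with $\sigma$). $\mathrm{Aut}_\Gamma(A_{2n})$ is the subgroup of $\mathrm{Aut}(A_{2n})$ generated by the inner automorphisms, $\sigma$ and $\iota$; every element has the form $\varphi_g\sigma^{\delta}\iota^{\varepsilon}$ with $\delta,\varepsilon\in\{0,1\}$. $\mathrm{Fix}(\gamma)=\{h\mid\gamma(h)=h\}$. ''Finite order'' means finite order in $\mathrm{Aut}(A_{2n})$. $H\le_{f.i.}K$ means that $H$ is a finite index subgroup of $K$.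
   Formalization: In item 1 the inner automorphism φ_g is assumed nontrivial (g not central): for g central, e.g. g = 1, φ_g is the identity, of order 1, and Fix(φ_g) is the whole nonabelian group A_{2n}, not Z. *)

(* Defs.v *)
From HB Require Import structures.
From mathcomp Require Import all_boot all_order all_algebra.
From mathcomp Require Import all_classical.

Set Implicit Arguments.
Unset Strict Implicit.
Unset Printing Implicit Defensive.

Local Open Scope classical_set_scope.
Local Open Scope group_scope.

Section Subgroups.
Variable G : groupType.
Implicit Types (H K S : set G) (g x y : G).

Definition is_subgroup H : Prop :=
  [/\ H 1, (forall x y, H x -> H y -> H (x * y)) & forall x, H x -> H x^-1].

Definition generated S : set G :=
  [set x | forall H, is_subgroup H -> S `<=` H -> H x].

Definition cyclic_sub g : set G := generated [set g].

Definition set_prod H K : set G := [set x * y | x in H & y in K].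

(* [set_prod H K] is then the internal direct product of [H] and [K]. *)
Definition is_direct H K : Prop :=
  (forall x y, H x -> K y -> x * y = y * x) /\ H `&` K = [set 1].

Definition left_coset x H : set G := [set x * h | h in H].

Definition finite_index H K : Prop :=
  [/\ is_subgroup H, is_subgroup K, H `<=` K &
      finite_set [set left_coset x H | x in K]].

Definition iso_to (Z : zmodType) H : Prop :=
  exists f : Z -> G,
    [/\ forall u v : Z, f (u + v)%R = f u * f v, injective f & range f = H].

Definition finite_order x : Prop := exists k : nat, (0 < k)%N /\ x ^+ k = 1.

End Subgroups.

(* The product of automorphisms is composition, [(f * g) x = f (g x)]. *)

Record aut (G : groupType) := Aut {
  aut_fun :> G -> G;
  aut_mulM : {morph aut_fun : x y / x * y};
  aut_bij : bijective aut_fun }.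

HB.instance Definition _ (G : groupType) := gen_eqMixin (aut G).
HB.instance Definition _ (G : groupType) := gen_choiceMixin (aut G).

Section AutGroup.
Variable G : groupType.
Implicit Types f g h : aut G.

Lemma aut_eq f g : f =1 g -> f = g.
Proof.
case: f g => [f fM fB] [g gM gB] /= /funext fg; case: _ / fg in gM gB *.
by rewrite (Prop_irrelevance fM gM) (Prop_irrelevance fB gB).
Qed.

Definition aut_one : aut G := @Aut G idfun (fun _ _ => erefl) (inv_bij (fun _ => erefl)).

Lemma aut_comp_morph f g : {morph f \o g : x y / x * y}.
Proof. by move=> x y; rewrite /= !aut_mulM. Qed.

Definition aut_comp f g : aut G :=
  Aut (aut_comp_morph f g) (bij_comp (aut_bij f) (aut_bij g)).

Lemma aut_has_inv f : exists g : G -> G, cancel f g /\ cancel g f.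
Proof. by case: (aut_bij f) => g fK gK; exists g. Qed.

Definition aut_inv_fun f : G -> G := sval (cid (aut_has_inv f)).

Lemma aut_funK f : cancel f (aut_inv_fun f).
Proof. by rewrite /aut_inv_fun; case: cid => g []. Qed.

Lemma aut_inv_funK f : cancel (aut_inv_fun f) f.
Proof. by rewrite /aut_inv_fun; case: cid => g []. Qed.

Lemma aut_inv_morph f : {morph aut_inv_fun f : x y / x * y}.
Proof. by move=> x y; apply: (can_inj (aut_funK f)); rewrite aut_mulM !aut_inv_funK. Qed.

Definition aut_inv f : aut G :=
  Aut (aut_inv_morph f) (Bijective (aut_inv_funK f) (aut_funK f)).

Lemma aut_compA : associative aut_comp.
Proof. by move=> f g h; apply: aut_eq. Qed.

Lemma aut_comp1f : left_id aut_one aut_comp.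
Proof. by move=> f; apply: aut_eq. Qed.

Lemma aut_compf1 : right_id aut_one aut_comp.
Proof. by move=> f; apply: aut_eq. Qed.

Lemma aut_compVf : left_inverse aut_one aut_inv aut_comp.
Proof. by move=> f; apply: aut_eq => x; apply: aut_funK. Qed.

Lemma aut_compfV : right_inverse aut_one aut_inv aut_comp.
Proof. by move=> f; apply: aut_eq => x; apply: aut_inv_funK. Qed.

HB.instance Definition _ := isGroup.Build (aut G)
  aut_compA aut_comp1f aut_compf1 aut_compVf aut_compfV.

Lemma aut_oneE x : (1 : aut G) x = x. Proof. by []. Qed.

Lemma aut_mulE f g x : (f * g) x = f (g x). Proof. by []. Qed.

Definition inner_fun (c h : G) : G := c * h * c^-1.

Lemma inner_morph c : {morph inner_fun c : x y / x * y}.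
Proof. by move=> x y; rewrite /inner_fun !mulgA mulgVK. Qed.

Lemma inner_bij c : bijective (inner_fun c).
Proof.
exists (inner_fun c^-1) => x; rewrite /inner_fun invgK !mulgA.
  by rewrite mulVg mul1g mulgVK.
by rewrite mulgV mul1g mulgK.
Qed.

Definition inner c : aut G := Aut (inner_morph c) (inner_bij c).

Definition fixed_sub f : set G := [set h | f h = h].

End AutGroup.

(* Group presentations.  A letter [(x, true)] stands for the generator [x] and
   [(x, false)] for its inverse; the presented group is the quotient of the
   words by the least congruence making these mutually inverse and identifying
   the two sides of each relation. *)

Section Presentation.
Variables (X : choiceType) (R : seq (X * bool) -> seq (X * bool) -> Prop).
Notation word := (seq (X * bool)).
Implicit Types u v w : word.

Definition letter_inv (l : X * bool) : X * bool := (l.1, ~~ l.2).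
Definition word_inv w : word := rev (map letter_inv w).

Inductive word_eq : word -> word -> Prop :=
| word_eq_refl u : word_eq u u
| word_eq_sym u v : word_eq u v -> word_eq v u
| word_eq_trans v u w : word_eq u v -> word_eq v w -> word_eq u w
| word_eq_cat u u' v v' :
    word_eq u u' -> word_eq v v' -> word_eq (u ++ v) (u' ++ v')
| word_eq_cancel l : word_eq [:: l; letter_inv l] [::]
| word_eq_rel u v : R u v -> word_eq u v.

Definition word_eqb u v : bool := `[< word_eq u v >].

Lemma word_eqb_refl : reflexive word_eqb.
Proof. by move=> u; apply/asboolP/word_eq_refl. Qed.

Lemma word_eqb_sym : symmetric word_eqb.
Proof. by move=> u v; apply/asboolP/asboolP; apply: word_eq_sym. Qed.

Lemma word_eqb_trans : transitive word_eqb.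
Proof.
by move=> v u w /asboolP uv /asboolP vw; apply/asboolP/(word_eq_trans uv).
Qed.

Canonical word_eqb_equiv :=
  EquivRel word_eqb word_eqb_refl word_eqb_sym word_eqb_trans.

Definition presented : Type := {eq_quot word_eqb}%qT.
HB.instance Definition _ := Choice.on presented.

Definition word_class w : presented := (\pi_({eq_quot word_eqb}) w)%qT.
Definition word_repr (p : presented) : word :=
  (repr (p : {eq_quot word_eqb}))%qT.

Lemma word_reprK p : word_class (word_repr p) = p.
Proof. exact: (@reprK _ {eq_quot word_eqb}%qT). Qed.

Lemma word_classP u v : word_class u = word_class v <-> word_eq u v.
Proof.
split=> [/eqmodP/asboolP//|uv].
by apply/eqmodP/asboolP.
Qed.

Lemma word_repr_class w : word_eq (word_repr (word_class w)) w.
Proof. by apply/word_classP; rewrite word_reprK. Qed.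

Lemma letter_invK : involutive letter_inv.
Proof. by case=> x b; rewrite /letter_inv /= negbK. Qed.

Lemma word_invK : involutive word_inv.
Proof.
by move=> w; rewrite /word_inv map_rev revK -map_comp map_id_in // => l _; rewrite /= letter_invK.
Qed.

Lemma word_eq_catV w : word_eq (w ++ word_inv w) [::].
Proof.
elim: w => [|l w IH]; first exact: word_eq_refl.
have -> : (l :: w) ++ word_inv (l :: w)
        = [:: l] ++ ((w ++ word_inv w) ++ [:: letter_inv l]).
  by rewrite /word_inv /= rev_cons -cats1 catA.
apply: word_eq_trans (word_eq_cancel l).
apply: (@word_eq_cat [:: l] [:: l] _ [:: letter_inv l]); first exact: word_eq_refl.
by apply: (@word_eq_cat _ [::] _ [:: letter_inv l]) IH _; apply: word_eq_refl.
Qed.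

Lemma word_eq_inv u v : word_eq u v -> word_eq (word_inv u) (word_inv v).
Proof.
move=> uv.
have Vu : word_eq (word_inv u ++ u) [::].
  by rewrite -{2}[u]word_invK; apply: word_eq_catV.
apply: (@word_eq_trans (word_inv u ++ (v ++ word_inv v))).
  rewrite -{1}[word_inv u]cats0; apply: word_eq_cat; first exact: word_eq_refl.
  exact/word_eq_sym/word_eq_catV.
rewrite catA -[X in word_eq _ X]cat0s; apply: word_eq_cat; last exact: word_eq_refl.
apply: word_eq_trans Vu; apply: word_eq_cat; first exact: word_eq_refl.
exact: word_eq_sym.
Qed.

Definition pres_one : presented := word_class [::].
Definition pres_mul (p q : presented) : presented :=
  word_class (word_repr p ++ word_repr q).
Definition pres_inv (p : presented) : presented :=
  word_class (word_inv (word_repr p)).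

Lemma pres_mul_class u v :
  pres_mul (word_class u) (word_class v) = word_class (u ++ v).
Proof. by apply/word_classP/word_eq_cat; apply: word_repr_class. Qed.

Lemma pres_inv_class u : pres_inv (word_class u) = word_class (word_inv u).
Proof. exact/word_classP/word_eq_inv/word_repr_class. Qed.

Lemma pres_mulA : associative pres_mul.
Proof.
move=> p q r; rewrite -(word_reprK p) -(word_reprK q) -(word_reprK r).
by rewrite !pres_mul_class catA.
Qed.

Lemma pres_mul1p : left_id pres_one pres_mul.
Proof. by move=> p; rewrite -(word_reprK p) pres_mul_class. Qed.

Lemma pres_mulp1 : right_id pres_one pres_mul.
Proof. by move=> p; rewrite -(word_reprK p) pres_mul_class cats0. Qed.

Lemma pres_mulpV : right_inverse pres_one pres_inv pres_mul.
Proof.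
move=> p; rewrite -(word_reprK p) pres_inv_class pres_mul_class.
exact/word_classP/word_eq_catV.
Qed.

Lemma pres_mulVp : left_inverse pres_one pres_inv pres_mul.
Proof.
move=> p; rewrite -(word_reprK p) pres_inv_class pres_mul_class.
by apply/word_classP; rewrite -{2}[word_repr p]word_invK; apply: word_eq_catV.
Qed.

HB.instance Definition _ := isGroup.Build presented
  pres_mulA pres_mul1p pres_mulp1 pres_mulVp pres_mulpV.

Definition pres_gen (x : X) : presented := word_class [:: (x, true)].

Section Lift.
Variables (H : groupType) (f : X -> H).

Definition letter_eval (l : X * bool) : H := if l.2 then f l.1 else (f l.1)^-1.
Definition word_eval w : H := foldr (fun l h => letter_eval l * h) 1 w.

(* The homomorphism extending [f], provided [f] respects the relations. *)
Definition pres_lift (p : presented) : H := word_eval (word_repr p).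

Lemma word_eval_cat u v : word_eval (u ++ v) = word_eval u * word_eval v.
Proof. by elim: u => [|l u IH] /=; rewrite ?mul1g // IH mulgA. Qed.

Hypothesis fR : forall u v, R u v -> word_eval u = word_eval v.

Lemma word_eval_eq u v : word_eq u v -> word_eval u = word_eval v.
Proof.
elim=> //= [u' v' w' _ -> _ -> //|u1 u2 v1 v2 _ e1 _ e2|[x []]].
- by rewrite !word_eval_cat e1 e2.
- by rewrite /letter_eval /= mulg1 mulgV.
- by rewrite /letter_eval /= mulg1 mulVg.
Qed.

Lemma pres_lift_class w : pres_lift (word_class w) = word_eval w.
Proof. exact/word_eval_eq/word_repr_class. Qed.

Lemma pres_liftM : {morph pres_lift : p q / p * q}.
Proof.
move=> p q; rewrite -(word_reprK p) -(word_reprK q).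
by rewrite [_ * _]pres_mul_class !pres_lift_class word_eval_cat.
Qed.

Lemma pres_lift_gen x : pres_lift (pres_gen x) = f x.
Proof. by rewrite pres_lift_class /= mulg1. Qed.

End Lift.

Lemma word_eval_gen w : word_eval pres_gen w = word_class w.
Proof.
elim: w => //= -[x b] w ->; rewrite -cat1s -pres_mul_class; congr (_ * _).
by case: b => //; rewrite /letter_eval /= [_^-1]pres_inv_class.
Qed.

End Presentation.

(* The even dihedral Artin group < a, b | (ab)^n = (ba)^n >, with [true]
   standing for the generator a and [false] for b. *)

Definition artin_rel (n : nat) (u v : seq (bool * bool)) : Prop :=
  u = flatten (nseq n [:: (true, true); (false, true)]) /\
  v = flatten (nseq n [:: (false, true); (true, true)]).

Definition artin (n : nat) : Type := presented (artin_rel n).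
HB.instance Definition _ (n : nat) := Group.on (artin n).

Definition art_a (n : nat) : artin n := pres_gen (artin_rel n) true.
Definition art_b (n : nat) : artin n := pres_gen (artin_rel n) false.
Definition Delta (n : nat) : artin n := (art_a n * art_b n) ^+ n.

Section ArtinAutomorphisms.
Variable n : nat.
Notation A := (artin n).
Notation a := (art_a n).
Notation b := (art_b n).

Lemma word_eval_flatten (H : groupType) (f : bool -> H) m w :
  word_eval f (flatten (nseq m w)) = word_eval f w ^+ m.
Proof. by elim: m => [|m IH] //=; rewrite word_eval_cat IH expgS. Qed.

Lemma artin_relE : (a * b) ^+ n = (b * a) ^+ n.
Proof.
have E : word_eval (pres_gen (artin_rel n)) (flatten (nseq n [:: (true, true); (false, true)]))
       = word_eval (pres_gen (artin_rel n)) (flatten (nseq n [:: (false, true); (true, true)])).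
  by rewrite !word_eval_gen; apply/word_classP/word_eq_rel.
by move: E; rewrite !word_eval_flatten /= /letter_eval /= !mulg1.
Qed.

Lemma artin_ext (H : groupType) (f g : A -> H) :
  {morph f : x y / x * y} -> {morph g : x y / x * y} ->
  f a = g a -> f b = g b -> f =1 g.
Proof.
move=> fM gM fga fgb x.
have f1 : f 1 = 1 by apply: (@mulgI _ (f 1)); rewrite -fM !mulg1.
have g1 : g 1 = 1 by apply: (@mulgI _ (g 1)); rewrite -gM !mulg1.
have fV y : f y^-1 = (f y)^-1 by apply: (@mulgI _ (f y)); rewrite -fM !mulgV f1.
have gV y : g y^-1 = (g y)^-1 by apply: (@mulgI _ (g y)); rewrite -gM !mulgV g1.
rewrite -(word_reprK x) -word_eval_gen.
elim: (word_repr x) => [|[y s] w IH]; first by rewrite /= f1 g1.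
rewrite /= [LHS]fM [RHS]gM IH; congr (_ * _).
rewrite /letter_eval /=; case: s y => [] [] //=.
- by rewrite [LHS]fV [RHS]gV; congr (_^-1).
- by rewrite [LHS]fV [RHS]gV; congr (_^-1).
Qed.

Definition sigma_gen (x : bool) : A := if x then b else a.
Definition iota_gen (x : bool) : A := if x then a^-1 else b^-1.

Definition sigma_fun : A -> A := pres_lift sigma_gen.
Definition iota_fun : A -> A := pres_lift iota_gen.

Lemma sigma_rel u v :
  artin_rel n u v -> word_eval sigma_gen u = word_eval sigma_gen v.
Proof.
case=> -> ->; rewrite !word_eval_flatten /= /letter_eval /= !mulg1.
exact/esym/artin_relE.
Qed.

Lemma iota_rel u v :
  artin_rel n u v -> word_eval iota_gen u = word_eval iota_gen v.
Proof.
case=> -> ->; rewrite !word_eval_flatten /= /letter_eval /= !mulg1.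
by rewrite -!invgM !expVgn artin_relE.
Qed.

Lemma sigma_morph : {morph sigma_fun : x y / x * y}.
Proof. exact: (pres_liftM sigma_rel). Qed.

Lemma iota_morph : {morph iota_fun : x y / x * y}.
Proof. exact: (pres_liftM iota_rel). Qed.

Lemma sigma_fun_a : sigma_fun a = b.
Proof. exact: (pres_lift_gen sigma_rel true). Qed.

Lemma sigma_fun_b : sigma_fun b = a.
Proof. exact: (pres_lift_gen sigma_rel false). Qed.

Lemma iota_fun_a : iota_fun a = a^-1.
Proof. exact: (pres_lift_gen iota_rel true). Qed.

Lemma iota_fun_b : iota_fun b = b^-1.
Proof. exact: (pres_lift_gen iota_rel false). Qed.

Lemma sigma_funK : involutive sigma_fun.
Proof.
apply: (@artin_ext A (sigma_fun \o sigma_fun) idfun) => //=.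
- by move=> x y /=; rewrite !sigma_morph.
- by rewrite sigma_fun_a sigma_fun_b.
- by rewrite sigma_fun_b sigma_fun_a.
Qed.

Lemma iota_funV x : iota_fun x^-1 = (iota_fun x)^-1.
Proof.
have i1 : iota_fun 1 = 1.
  by apply: (@mulgI _ (iota_fun 1)); rewrite -iota_morph !mulg1.
by apply: (@mulgI _ (iota_fun x)); rewrite -iota_morph !mulgV i1.
Qed.

Lemma iota_funK : involutive iota_fun.
Proof.
apply: (@artin_ext A (iota_fun \o iota_fun) idfun) => //=.
- by move=> x y /=; rewrite !iota_morph.
- by rewrite iota_fun_a iota_funV iota_fun_a invgK.
- by rewrite iota_fun_b iota_funV iota_fun_b invgK.
Qed.

Definition art_sigma : aut A := Aut sigma_morph (inv_bij sigma_funK).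
Definition art_iota : aut A := Aut iota_morph (inv_bij iota_funK).

Definition AutGamma : set (aut A) :=
  generated ([set inner g | g in [set: A]] `|` [set art_sigma; art_iota]).

End ArtinAutomorphisms.

Arguments AutGamma n : clear implicits.

(* Main.v *)
Require Import Defs.
From HB Require Import structures.
From mathcomp Require Import all_boot all_order all_algebra.
From mathcomp Require Import all_classical.
From mathcomp Require Import zify ring.

Set Implicit Arguments.
Unset Strict Implicit.
Unset Printing Implicit Defensive.

Local Open Scope classical_set_scope.
Local Open Scope group_scope.

(** Put m = 2n and let W be the free product of m copies of Z/2, indexed by Z/m.
    The integers act on Z/m by translations and the sign by x |-> -x, hence on W;
    let E be the resulting semidirect product, with elements (w, k, e).  Writing
    sh = (s_0, 0, +) and st = (1, 1, +), the map a |-> st sh, b |-> sh st embeds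
    A_{2n} in E as the subgroup of those (w, k, +) with |w| + k even, it sends
    Delta to (1, m, +), and sigma and iota become conjugation by sh and by
    sh (1, 0, -).  So each automorphism phi of the theorem is conjugation by some
    y in E, and Fix(phi) is the centraliser of y in A_{2n}.

    Cyclic reduction in W conjugates y = (w, d) to one of three forms: w = 1;
    w = s_x with d x = x; or w nonempty with last letter different from the image
    under d of the first letter.  In the first two cases phi has finite order and
    the centraliser is computed by inspecting letters.  In the last case the
    words w, w d(w), w d(w) d^2(w), ... are all reduced, so phi has infinite order;
    an element commuting with y eventually translates the prefixes of the
    infinite word w d(w) d^2(w) ..., and the translation length is an additive
    function on Fix(phi) whose kernel consists of powers of Delta.  This kernel
    is all of <Delta> when the sign of y is +, and trivial when it is -, since
    then y inverts Delta. *)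

(** * Subgroups with an additive integer-valued length *)

Section IntPowers.
Variable G : groupType.
Implicit Types (x y z g h u : G) (i j : int) (H K : set G).

Definition zpow g i : G := match i with Posz k => g ^+ k | Negz k => g ^- k.+1 end.

Lemma zpowS g i : zpow g (i + 1)%R = g * zpow g i.
Proof.
case: i => k; first by rewrite -PoszD addn1 /= expgS.
have -> : (Negz k + 1 = - k%:Z)%R by lia.
by case: k => [|k]; rewrite ?mulgV //= -[k.+2]/(k.+1.+1) (expgSr g k.+1) invgM mulVKg.
Qed.

Lemma zpow1 g : zpow g 1 = g. Proof. by []. Qed.

Lemma zpowD g i j : zpow g (i + j)%R = zpow g i * zpow g j.
Proof.
elim/int_ind: i => [|k IH|k IH]; first by rewrite GRing.add0r mul1g.
  have -> : (k.+1%:Z + j = (k%:Z + j) + 1)%R by lia.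
  have -> : (k.+1%:Z = k%:Z + 1)%R by lia.
  by rewrite !zpowS IH mulgA.
apply: (mulgI g); rewrite mulgA -!zpowS.
have -> : (- k.+1%:Z + j + 1 = - k%:Z + j)%R by lia.
by have -> : (- k.+1%:Z + 1 = - k%:Z)%R by lia.
Qed.

Lemma zpowN g i : zpow g (- i)%R = (zpow g i)^-1.
Proof. by apply: (mulIg (zpow g i)); rewrite -zpowD GRing.addNr mulVg. Qed.

Lemma commute_zpow x g i : commute x g -> commute x (zpow g i).
Proof. by move=> xg; case: i => k; [|apply: commuteV]; apply: commuteX. Qed.

Lemma subgroup_zpow H g i : is_subgroup H -> H g -> H (zpow g i).
Proof.
case=> H1 HM HV Hg; have HX k : H (g ^+ k).
  by elim: k => [//|k IH]; rewrite expgS; apply: HM.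
by case: i => k /=; [|apply: HV]; apply: HX.
Qed.

Lemma cyclic_subE g : cyclic_sub g = range (zpow g).
Proof.
apply/seteqP; split=> x /=.
  move/(_ (range (zpow g))); apply=> [|_ ->]; last by exists 1%R.
  split=> [|_ _ [i _ <-] [j _ <-]|_ [i _ <-]]; first by exists 0%R.
    by exists (i + j)%R => //; rewrite zpowD.
  by exists (- i)%R => //; rewrite zpowN.
by case=> i _ <- H sH /(_ g erefl); apply: subgroup_zpow.
Qed.

Lemma cyclic_sub_subgroup g : is_subgroup (cyclic_sub g).
Proof.
split=> [|x y Hx Hy|x Hx] H sH gH; have [H1 HM HV] := sH => //.
  by apply: HM; [apply: Hx|apply: Hy].
by apply: HV; apply: Hx.
Qed.

Lemma iso_to_cyclic_sub g :
  (forall i, zpow g i = 1 -> i = 0%R) -> iso_to int (cyclic_sub g).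
Proof.
move=> g_inf; exists (zpow g); split; first exact: zpowD.
  move=> i j ij; apply/eqP; rewrite -GRing.subr_eq0; apply/eqP/g_inf.
  by rewrite zpowD zpowN ij mulgV.
by rewrite cyclic_subE.
Qed.

End IntPowers.

Lemma zpow_morph (G H : groupType) (f : G -> H) : {morph f : x y / x * y} ->
  forall g i, f (zpow g i) = zpow (f g) i.
Proof.
move=> fM g i; have f1 : f 1 = 1 by apply: (mulgI (f 1)); rewrite -fM !mulg1.
have fV y : f y^-1 = (f y)^-1 by apply: (mulgI (f y)); rewrite -fM !mulgV f1.
have fX k : f (g ^+ k) = f g ^+ k by elim: k => // k IH; rewrite !expgS fM IH.
by case: i => k /=; rewrite ?fV fX.
Qed.

Section AdditiveLength.
Variables (G : groupType) (K : set G) (l : G -> int).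
Hypothesis sK : is_subgroup K.
Hypothesis lM : forall x y, K x -> K y -> l (x * y) = (l x + l y)%R.

Lemma length1 : l 1 = 0%R.
Proof. by case: sK => K1 _ _; have := lM K1 K1; rewrite mulg1; lia. Qed.

Lemma lengthV x : K x -> l x^-1 = (- l x)%R.
Proof. by case: sK => _ _ KV Kx; have := lM Kx (KV _ Kx); rewrite mulgV length1; lia. Qed.

Lemma length_zpow x i : K x -> l (zpow x i) = (i * l x)%R.
Proof.
move=> Kx; have lX k : l (x ^+ k) = (k%:Z * l x)%R.
  elim: k => [|k IH]; first by rewrite length1 GRing.mul0r.
  by rewrite expgS lM ?IH //; [lia | apply: (subgroup_zpow (Posz k) sK)].
case: i => k; first exact: lX.
by rewrite /= lengthV ?lX; [lia|apply: (subgroup_zpow (Posz k.+1) sK)].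
Qed.

(** The values of [l] on [K] form a nonzero subgroup of the integers; Euclidean division by the
    least positive value leaves remainder 0. *)
Lemma exists_min_length u : K u -> l u <> 0%R ->
  exists h, [/\ K h, (0 < l h)%R & forall x, K x -> exists q, l x = (q * l h)%R].
Proof.
move=> Ku lu; have [K1 KM KV] := sK.
pose P k := `[< exists x, K x /\ l x = Posz k.+1 >].
have exP : exists k, P k.
  case: (Num.Theory.ltrgt0P (l u)) lu => // lu _.
    by exists `|l u|.-1%N; apply/asboolP; exists u; split=> //; lia.
  by exists `|l u|.-1%N; apply/asboolP; exists u^-1; rewrite lengthV //; split; [apply: KV|lia].
case: (ex_minnP exP) => k /asboolP[h [Kh lh]] kmin; exists h; split=> //; first by rewrite lh.
move=> x Kx; exists (l x %/ l h)%Z.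
have Ky : K (x * zpow h (- (l x %/ l h)%Z)%R) by apply: KM => //; apply: subgroup_zpow.
have ly : l (x * zpow h (- (l x %/ l h)%Z)%R) = (l x %% l h)%Z.
  rewrite lM ?length_zpow //; last exact: subgroup_zpow.
  by rewrite {1}(divz_eq (l x) (l h)); lia.
have lt0 : (0 <= l x %% l h < l h)%Z%R.
  by rewrite modz_ge0 ?ltz_pmod // lh.
case E: (l x %% l h)%Z lt0 => [[|j]|//] lt0; first by rewrite {1}(divz_eq (l x) (l h)) E; lia.
have : (k <= j)%N.
  by apply: kmin; apply/asboolP; exists (x * zpow h (- (l x %/ l h)%Z)%R); rewrite ly.
by move: lt0; rewrite lh; lia.
Qed.

(** The coset of [x] depends only on [l x] modulo [N], so there are at most |N| cosets. *)
Lemma finite_index_length H (N : int) : is_subgroup H -> H `<=` K -> N <> 0%R ->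
  (forall x, K x -> (N %| l x)%Z -> H x) -> finite_index H K.
Proof.
move=> sH HK N0 HN; split=> //; have [H1 HM HV] := sH; have [K1 KM KV] := sK.
have cosetE x y : H (x^-1 * y) -> left_coset x H = left_coset y H.
  move=> xy; apply/seteqP; split=> _ [h Hh <-].
    exists (y^-1 * x * h); last by rewrite !mulgA mulgV mul1g.
    by apply: HM => //; rewrite -[x in y^-1 * x]invgK -invgM; apply: HV.
  exists (x^-1 * y * h); last by rewrite !mulgA mulgV mul1g.
  exact: HM.
(* One coset per residue; a residue that is not attained gets an arbitrary value, harmless because
   the image only has to cover all cosets. *)
pose c i := get (fun C => exists x, [/\ K x, (l x %% N)%Z = Posz i & C = left_coset x H]).
apply: (@sub_finite_set _ _ [set c i | i in `I_(`|N|%N)]).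
  move=> _ [x Kx <-]; exists `|(l x %% N)%Z|%N.
    by have := ltz_mod (l x) (_ : N != 0%R); rewrite /=; move/(_ ltac:(lia)); lia.
  have Ni : (l x %% N)%Z = Posz `|(l x %% N)%Z| by have := @modz_ge0 (l x) N; lia.
  have [y [Ky ly ->]] :
      exists y, [/\ K y, (l y %% N)%Z = (l x %% N)%Z & c `|(l x %% N)%Z|%N = left_coset y H].
    rewrite /c; case: xgetP => [C -> [y [Ky ly ->]]|/(_ (left_coset x H)) []].
      by exists y; rewrite ly -Ni.
    by exists x; rewrite -Ni.
  apply: cosetE; apply: HN; first exact/KM/Kx/KV.
  rewrite lM ?lengthV //; last exact: KV.
  by rewrite GRing.addrC -eqz_mod_dvd ly.
exact/finite_image/finite_II.
Qed.

(** Here [l] embeds [K] in the integers, so an element of least positive length generates [K]. *)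
Lemma length_inj_iso_int u : (forall x, K x -> l x = 0%R -> x = 1) ->
  K u -> l u <> 0%R -> iso_to int K.
Proof.
move=> l0 Ku lu; have [h [Kh lh hK]] := exists_min_length Ku lu.
have -> : K = cyclic_sub h.
  rewrite cyclic_subE; apply/seteqP; split=> [x Kx|_ [i _ <-]]; last exact: subgroup_zpow.
  have [q lx] := hK x Kx; exists q => //.
  have [_ KM KV] := sK; have Kq : K (zpow h q) by exact: subgroup_zpow.
  apply: (mulIg x^-1); rewrite mulgV; apply: l0; first by apply: KM => //; apply: KV.
  rewrite lM ?lengthV ?length_zpow //; last exact: KV.
  by rewrite lx; lia.
apply: iso_to_cyclic_sub => i /(congr1 l); rewrite length_zpow // length1.
by move=> /eqP; rewrite GRing.mulf_eq0 => /orP[/eqP//|]; lia.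
Qed.

Lemma length_inj_finite_index u : (forall x, K x -> l x = 0%R -> x = 1) ->
  K u -> l u <> 0%R -> finite_index (cyclic_sub u) K.
Proof.
move=> l0 Ku lu; apply: (@finite_index_length _ (l u)) => //.
- exact: cyclic_sub_subgroup.
- by rewrite cyclic_subE => _ [i _ <-]; apply: subgroup_zpow.
move=> x Kx /dvdzP[q lx]; rewrite cyclic_subE; exists q => //.
have [_ KM KV] := sK; have Kq : K (zpow u q) by exact: subgroup_zpow.
apply: (mulIg x^-1); rewrite mulgV; apply: l0; first by apply: KM => //; apply: KV.
rewrite lM ?lengthV ?length_zpow //; last exact: KV.
by rewrite lx; lia.
Qed.

(** * Additive lengths with infinite cyclic central kernel *)

Section CentralKernel.
Variables z u : G.
Hypothesis l0 : forall x, K x -> l x = 0%R -> exists i, x = zpow z i.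
Hypothesis z_inf : forall i, zpow z i = 1 -> i = 0%R.
Hypothesis zC : forall x, K x -> commute x z.
Hypotheses (Kz : K z) (lz : l z = 0%R) (Ku : K u) (lu : l u <> 0%R).

Lemma length_factor h x q : K h -> K x -> l x = (q * l h)%R ->
  exists i, x = zpow h q * zpow z i.
Proof.
move=> Kh Kx lx; have [_ KM KV] := sK.
have Kq : K (zpow h q) by exact: subgroup_zpow.
have [|i E] := @l0 ((zpow h q)^-1 * x) (KM _ _ (KV _ Kq) Kx).
  by rewrite lM ?lengthV ?length_zpow //; [rewrite lx; lia | apply: KV].
by exists i; rewrite -E mulVKg.
Qed.

(** [K] is an extension of the integers by the central group generated by [z]; an element [h] of
    least positive length splits it. *)
Lemma length_iso_int2 : iso_to (int * int)%type K.
Proof.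
have [_ KM KV] := sK; have [h [Kh lh hK]] := exists_min_length Ku lu.
have hz i j : zpow h i * zpow z j = zpow z j * zpow h i.
  by apply/commute_zpow/commute_sym/commute_zpow/commute_sym/zC.
have fM (v w : int * int) : zpow h (v + w)%R.1 * zpow z (v + w)%R.2
    = (zpow h v.1 * zpow z v.2) * (zpow h w.1 * zpow z w.2).
  by rewrite !zpowD !mulgA -(mulgA (zpow h v.1) (zpow z v.2)) -hz !mulgA.
exists (fun v => zpow h v.1 * zpow z v.2); split=> //.
  move=> v w vw; have E : zpow h (v - w)%R.1 * zpow z (v - w)%R.2 = 1.
    apply: (mulIg (zpow h w.1 * zpow z w.2)); rewrite -fM mul1g.
    by rewrite GRing.subrK vw.
  have Kv1 : K (zpow h (v - w)%R.1) by exact: subgroup_zpow.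
  have Kv2 : K (zpow z (v - w)%R.2) by exact: subgroup_zpow.
  have v1 : (v - w)%R.1 = 0%R.
    move/(congr1 l): E; rewrite lM // !length_zpow // lz length1.
    by move=> /eqP; rewrite GRing.mulr0 GRing.addr0 GRing.mulf_eq0 => /orP[/eqP//|]; lia.
  have v2 : (v - w)%R.2 = 0%R by move: E; rewrite v1 mul1g => /z_inf.
  by case: v w v1 v2 {vw E Kv1 Kv2} => [v1 v2] [w1 w2] /= ? ?; congr (_, _); lia.
apply/seteqP; split=> [_ [v _ <-]|x Kx].
  by apply: KM; apply: subgroup_zpow.
have [q /(length_factor Kh Kx)[i ->]] := hK x Kx.
by exists (q, i).
Qed.

Lemma length_direct : is_direct (cyclic_sub u) (cyclic_sub z).
Proof.
rewrite !cyclic_subE; split=> [_ _ [i _ <-] [j _ <-]|].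
  by apply/commute_zpow/commute_sym/commute_zpow/commute_sym/zC.
apply/seteqP; split=> [_ [[i _ <-] [j _ /(congr1 l)]]|_ ->]; last by split; exists 0%R.
rewrite !length_zpow // lz GRing.mulr0 => /esym/eqP.
by rewrite GRing.mulf_eq0 => /orP[/eqP->//|/eqP].
Qed.

Lemma length_finite_index2 :
  finite_index (set_prod (cyclic_sub u) (cyclic_sub z)) K.
Proof.
have [_ KM KV] := sK.
have uz i j : zpow u i * zpow z j = zpow z j * zpow u i.
  by apply/commute_zpow/commute_sym/commute_zpow/commute_sym/zC.
have HE : set_prod (cyclic_sub u) (cyclic_sub z)
    = [set x | exists i j, x = zpow u i * zpow z j].
  apply/seteqP; rewrite /set_prod !cyclic_subE; split=> x.
    by case=> _ [i _ <-] [_ [j _ <-] <-]; exists i, j.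
  by case=> i [j ->]; exists (zpow u i); [exists i|exists (zpow z j); [exists j|]].
rewrite HE; apply: (@finite_index_length _ (l u)) => //.
- split=> [|_ _ [i [j ->]] [i' [j' ->]]|_ [i [j ->]]].
  + by exists 0%R, 0%R; rewrite mulg1.
  + exists (i + i')%R, (j + j')%R.
    by rewrite !zpowD !mulgA -(mulgA (zpow u i) (zpow z j)) -uz !mulgA.
  + by exists (- i)%R, (- j)%R; rewrite uz !zpowN invgM.
- by move=> _ [i [j ->]]; apply: KM; apply: subgroup_zpow.
- move=> x Kx /dvdzP[q lx]; exists q.
  exact: length_factor Ku Kx lx.
Qed.

End CentralKernel.
End AdditiveLength.

(** * Free products of copies of Z/2 *)

Section Involutions.
Variable X : choiceType.
Implicit Types (x y : X) (s : seq X).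

Definition reduced s := sorted (fun x y => x != y) s.

Record cox := Cox { cox_seq :> seq X; cox_reduced : reduced cox_seq }.
HB.instance Definition _ := [isSub for cox_seq].
HB.instance Definition _ := [Choice of cox by <:].
Implicit Types u v w : cox.

Lemma cox_inj : injective cox_seq. Proof. exact: val_inj. Qed.

Definition push x s := if s is y :: s' then if x == y then s' else x :: s else [:: x].

Lemma push_reduced x s : reduced s -> reduced (push x s).
Proof.
case: s => [//|y s] /= sP; case: eqVneq => [_|xy]; first exact: path_sorted sP.
by rewrite /= xy.
Qed.

Lemma pushK x s : reduced s -> push x (push x s) = s.
Proof.
case: s => [_|y s] /=; first by rewrite eqxx.
case: (eqVneq x y) => [<-|xy] sP; last by rewrite /= eqxx.
by case: s sP => [//|z s] /= /andP[/negPf->].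
Qed.

Lemma push_cons x s : reduced (x :: s) -> push x s = x :: s.
Proof. by case: s => [//|y s] /= /andP[/negPf->]. Qed.

Definition cpush x w := Cox (push_reduced x (cox_reduced w)).

Lemma cpushK x : involutive (cpush x).
Proof. by move=> w; apply/val_inj/pushK/cox_reduced. Qed.

Section Action.
Variables (T : Type) (F : X -> T -> T).
Hypothesis FK : forall x, involutive (F x).

Lemma foldr_push t x s : foldr F t (push x s) = F x (foldr F t s).
Proof. by case: s => [//|y s] /=; case: eqVneq => [->|//]; rewrite FK. Qed.

Definition cact w t := foldr F t w.

End Action.

Definition cox_one := @Cox [::] isT.
Definition cmul u v : cox := cact cpush u v.

(** [push] only inserts a letter or cancels a repeated one, which does not affect a composite of
    involutions. Taking [cpush] for [F] gives associativity. *)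
Lemma cactM (T : Type) (F : X -> T -> T) (FK : forall x, involutive (F x)) u v t :
  cact F (cmul u v) t = cact F u (cact F v t).
Proof.
rewrite /cact /cmul /cact; elim: (cox_seq u) => //= x s IH.
by rewrite -IH -foldr_push.
Qed.

Lemma cmulA : associative cmul.
Proof. by move=> u v w; rewrite /cmul cactM //; apply: cpushK. Qed.

Lemma cmul1w : left_id cox_one cmul. Proof. by []. Qed.

Lemma foldr_cpush v s : reduced (s ++ v) -> cox_seq (foldr cpush v s) = s ++ v.
Proof.
elim: s => //= x s IH sP; rewrite IH ?push_cons //.
exact: path_sorted sP.
Qed.

Lemma cmulw1 : right_id cox_one cmul.
Proof.
by move=> w; apply: val_inj; rewrite /= /cmul /cact foldr_cpush cats0 //; case: w.
Qed.

Lemma rev_reduced w : reduced (rev w).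
Proof.
rewrite /reduced rev_sorted; case: w => s; rewrite /reduced /=.
by under eq_sorted do rewrite eq_sym.
Qed.

Definition cinv w : cox := Cox (rev_reduced w).

Lemma cmulVw : left_inverse cox_one cinv cmul.
Proof.
move=> w; apply: val_inj; rewrite /cmul /cact /=.
suff H v s : cox_seq v = s -> cox_seq (foldr cpush v (rev s)) = [::] by exact: H.
elim: s v => [//|x s IH] v vs; rewrite rev_cons foldr_rcons; apply: IH.
by rewrite /= vs /= eqxx.
Qed.

Lemma cinvK : involutive cinv.
Proof. by move=> w; apply: val_inj; rewrite /= revK. Qed.

Lemma cmulwV : right_inverse cox_one cinv cmul.
Proof. by move=> w; rewrite -{1}[w]cinvK cmulVw. Qed.

HB.instance Definition _ := isGroup.Build cox cmulA cmul1w cmulw1 cmulVw cmulwV.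

Definition refl x : cox := @Cox [:: x] isT.

Lemma reflK x : refl x * refl x = 1.
Proof. by apply: val_inj; rewrite /= eqxx. Qed.

Lemma reflV x : (refl x)^-1 = refl x.
Proof. exact: val_inj. Qed.

Lemma cox_mulE u v : reduced (u ++ v) -> cox_seq (u * v) = u ++ v.
Proof. exact: foldr_cpush. Qed.

Lemma refl_mulE x v : cox_seq (refl x * v) = push x v.
Proof. by []. Qed.

Lemma cox_cons x s (sP : reduced (x :: s)) (sP' : reduced s) :
  Cox sP = refl x * Cox sP'.
Proof. by apply: val_inj; rewrite /= push_cons. Qed.

Lemma cox_ind (P : cox -> Prop) : P 1 -> (forall x w, P w -> P (refl x * w)) -> forall w, P w.
Proof.
move=> P1 PS [s sP]; elim: s sP => [|x s IH] sP.
  by rewrite (_ : Cox sP = 1) //; apply: val_inj.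
by rewrite (cox_cons sP (path_sorted sP)); apply: PS; apply: IH.
Qed.

Lemma cactM_mul (T : Type) (F : X -> T -> T) (FK : forall x, involutive (F x)) u v t :
  cact F (u * v) t = cact F u (cact F v t).
Proof. exact: cactM. Qed.

Lemma cox_inv_seq u : cox_seq u^-1 = rev u. Proof. by []. Qed.

Lemma odd_size_push x s : odd (size (push x s)) = ~~ odd (size s).
Proof. by case: s => [//|y s] /=; case: (x == y); rewrite /= ?negbK. Qed.

Lemma odd_size_mul u v : odd (size (u * v)%g) = odd (size u) (+) odd (size v).
Proof.
elim/cox_ind: u => [|x u IH]; first by rewrite mul1g.
by rewrite -mulgA !refl_mulE !odd_size_push IH addNb.
Qed.

(** The endomorphism induced by [g] on letters; as [g] may identify letters, the image is multiplied
    out rather than mapped. *)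
Definition wmap (g : X -> X) w : cox := cact (fun x => cpush (g x)) w 1.

Lemma wmapM g : {morph wmap g : u v / u * v}.
Proof.
move=> u v; rewrite /wmap cactM_mul; last by move=> x; apply: cpushK.
rewrite /cact; elim: (cox_seq u) => [|x s IH]; first by rewrite mul1g.
rewrite /= IH; exact: (mulgA (refl (g x))).
Qed.

Lemma wmap1 g : wmap g 1 = 1. Proof. by []. Qed.

Lemma wmap_refl g x : wmap g (refl x) = refl (g x). Proof. exact: val_inj. Qed.

Lemma wmap_seq g w : injective g -> cox_seq (wmap g w) = map g w.
Proof.
move=> g_inj; rewrite /wmap /cact; case: w => /=; elim=> [//|x s IH] sP /=.
rewrite IH; last exact: path_sorted sP.
by case: s sP {IH} => [//|y s] /= /andP[xy _]; rewrite (inj_eq g_inj) (negPf xy).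
Qed.

Lemma eq_wmap g g' : g =1 g' -> wmap g =1 wmap g'.
Proof. by move=> gg w; rewrite /wmap /cact; elim: (cox_seq w) => //= x s ->; rewrite gg. Qed.

Lemma wmap_comp g g' w : wmap (g \o g') w = wmap g (wmap g' w).
Proof. by elim/cox_ind: w => // x w IH; rewrite !wmapM !wmap_refl IH. Qed.

Lemma wmap_id w : wmap id w = w.
Proof. by elim/cox_ind: w => // x w IH; rewrite wmapM wmap_refl IH. Qed.

End Involutions.

(** * Infinite reduced words and their prefixes *)

Section Rays.
Variable X : choiceType.
Implicit Types (p q : nat -> X) (w u v : cox X).

Fixpoint pre p k : cox X := if k is k'.+1 then refl (p 0%N) * pre (p \o succn) k' else 1.

Definition ray p := forall i, p i != p i.+1.

Lemma ray_shift p : ray p -> ray (p \o succn). Proof. by move=> pP i; apply: pP. Qed.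

Lemma reduced_mkseq p k : ray p -> reduced (mkseq p k).
Proof.
move=> pP; rewrite /reduced; apply/(sortedP (p 0%N)) => i; rewrite size_mkseq => lik.
by rewrite !nth_mkseq //; lia.
Qed.

Lemma mkseq_cons (T : Type) (f : nat -> T) k : mkseq f k.+1 = f 0%N :: mkseq (f \o succn) k.
Proof. by rewrite /mkseq /= -[1%N]addn0 iotaDl -map_comp. Qed.

Lemma pre_seq p k : ray p -> cox_seq (pre p k) = mkseq p k.
Proof.
elim: k p => [//|k IH] p pP; rewrite /= IH; last exact: ray_shift.
by rewrite mkseq_cons push_cons // -mkseq_cons reduced_mkseq.
Qed.

Lemma size_pre p k : ray p -> size (pre p k) = k.
Proof. by move=> pP; rewrite pre_seq ?size_mkseq. Qed.

Lemma eq_pre p q k : (forall i, (i < k)%N -> p i = q i) -> pre p k = pre q k.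
Proof.
elim: k p q => [//|k IH] p q pq /=; rewrite pq // (IH _ (q \o succn)) // => i ik.
exact: pq.
Qed.

Lemma pre_add p i j : pre p (i + j) = pre p i * pre (fun k => p (i + k)%N) j.
Proof.
elim: i p => [|i IH] p; first by rewrite mul1g.
by rewrite addSn /= IH -mulgA.
Qed.

Lemma preS p k : pre p k.+1 = pre p k * refl (p k).
Proof. by rewrite -addn1 pre_add /= mulg1 addn0. Qed.

Lemma wmap_pre g p k : wmap g (pre p k) = pre (g \o p) k.
Proof. by elim: k p => [//|k IH] p; rewrite /= wmapM wmap_refl IH. Qed.

(** Each letter of [w] either cancels the first letter of the ray or is put in front of it, so only
    a finite initial piece changes. *)
Lemma ray_mul w p : ray p -> exists q a b,
  ray q /\ forall j, w * pre p (a + j) = pre q (b + j).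
Proof.
elim/cox_ind: w p => [|x w IH] p pP; first by exists p, 0%N, 0%N; split=> // j; rewrite mul1g.
have [q [a [b [qP E]]]] := IH p pP.
have [xq|xq] := eqVneq x (q 0%N).
  exists (q \o succn), a.+1, b; split; first exact: ray_shift.
  by move=> j; rewrite addSnnS -mulgA E addnS /= mulgA xq reflK mul1g.
exists (fun i => if i is i'.+1 then q i' else x), a, b.+1; split; first by case.
by move=> j; rewrite -mulgA E.
Qed.

Lemma reduced_cat (s : seq X) x y t : reduced (rcons s x) -> reduced (y :: t) -> x != y ->
  reduced (rcons s x ++ y :: t).
Proof.
case: s => [|h s] /= sx yt xy; first by rewrite xy.
by rewrite cat_path sx last_rcons /= xy.
Qed.

(** Rays that differ at position [i] share at most [i] initial letters, so in the Cayley tree their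
    prefixes of lengths [b] and [a] are at distance at least a + b - 2i. The induction strips a
    common first letter. *)
Lemma ray_diverge p q i : ray p -> ray q -> p i != q i ->
  forall a b, (i < a)%N -> (i < b)%N ->
  (a + b <= size ((pre q a)^-1 * pre p b)%g + i.*2)%N.
Proof.
elim: i p q => [|i IH] p q pP qP pq [|a] [|b] // ia ib;
  have [E|E] := eqVneq (p 0%N) (q 0%N); try by case/eqP: pq.
2: { rewrite /= invgM reflV -mulgA -E (mulgA (refl _)) reflK mul1g.
  have := IH _ _ (ray_shift pP) (ray_shift qP) pq a b ia ib.
  by rewrite doubleS !addSn !addnS !ltnS; exact. }
all: rewrite cox_mulE cox_inv_seq ?size_cat ?size_rev !pre_seq ?size_mkseq //; try lia.
all: rewrite 2!mkseq_cons rev_cons reduced_cat // 1?eq_sym // -?mkseq_cons ?reduced_mkseq //.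
all: rewrite -rev_cons -mkseq_cons -(pre_seq _ qP); exact: rev_reduced.
Qed.

End Rays.

(** * The semidirect product and cyclic reduction *)

Lemma intr_Zp_eq0 m (k : int) : (1 < m)%N -> (k%:~R = 0 :> 'Z_m)%R <-> (m %| k)%Z.
Proof.
move=> m1; have m0 : ((m%:Z)%:~R = 0 :> 'Z_m)%R by exact: pchar_Zp.
split=> [|/dvdzP[q ->]]; last by rewrite GRing.rmorphM /= m0 GRing.mulr0.
rewrite {1}(divz_eq k m) GRing.rmorphD GRing.rmorphM /= m0 GRing.mulr0 GRing.add0r.
have : (0 <= k %% m < m)%Z%R by rewrite modz_ge0 ?ltz_pmod //; lia.
case E: (k %% m)%Z => [r|//] /andP[_ rm] /(congr1 val) /=.
rewrite val_Zp_nat // modn_small; last by lia.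
by move=> r0; apply/dvdz_mod0P; rewrite E r0.
Qed.

Section Extended.
Variable m : nat.
Notation X := 'Z_m.
Notation W := (cox X).
Implicit Types (x : X) (u v w : W) (e : bool) (k : int).

(* [ext_e = true] stands for the sign -. *)
Record ext := Ext { ext_w : W; ext_k : int; ext_e : bool }.
HB.instance Definition _ := gen_eqMixin ext.
HB.instance Definition _ := gen_choiceMixin ext.
Implicit Types (g h : ext).

Definition sg e k : int := if e then (- k)%R else k.
Definition aff h x : X := ((ext_k h)%:~R + if ext_e h then - x else x)%R.
(** An action of E on the set W, the vertices of the Cayley tree, and not by homomorphisms;
    [ext_w g] is the image of 1. *)
Definition act h w : W := ext_w h * wmap (aff h) w.

Definition ext_one := Ext 1 0 false.
Definition ext_mul g h : ext :=
  Ext (act g (ext_w h)) (ext_k g + sg (ext_e g) (ext_k h))%R (ext_e g (+) ext_e h).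

Lemma aff_mul g h : aff (ext_mul g h) =1 aff g \o aff h.
Proof.
case: g h => [v k e] [v' k' e'] x; rewrite /aff /=.
by case: e e' => [] [] /=; rewrite ?GRing.rmorphD ?GRing.rmorphN /=; ring.
Qed.

Lemma act_ext_mul g h w : act (ext_mul g h) w = act g (act h w).
Proof. by rewrite /act /= wmapM (eq_wmap (@aff_mul g h)) wmap_comp mulgA. Qed.

Lemma aff_one : aff ext_one =1 id.
Proof. by move=> x; rewrite /aff /= GRing.add0r. Qed.

Lemma act_one w : act ext_one w = w.
Proof. by rewrite /act (eq_wmap aff_one) wmap_id mul1g. Qed.

Lemma ext_mulA : associative ext_mul.
Proof.
move=> g h i; rewrite {1 3}/ext_mul act_ext_mul /= addbA; congr Ext.
by rewrite /sg; case: (ext_e g); case: (ext_e h) => /=; lia.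
Qed.

Lemma ext_mul1g : left_id ext_one ext_mul.
Proof. by case=> w k e; rewrite /ext_mul act_one /= GRing.add0r. Qed.

Lemma ext_mulg1 : right_id ext_one ext_mul.
Proof.
case=> w k e; rewrite /ext_mul /act /= mulg1 addbF; congr Ext.
by case: e => /=; lia.
Qed.

Definition ext_inv g : ext :=
  let d := Ext 1 (- sg (ext_e g) (ext_k g))%R (ext_e g) in
  Ext (wmap (aff d) (ext_w g)^-1) (ext_k d) (ext_e d).

Lemma ext_mulVg : left_inverse ext_one ext_inv ext_mul.
Proof.
case=> w k e; rewrite /ext_mul /ext_inv /act /=.
rewrite (@eq_wmap _ _ (aff (Ext 1 (- sg e k)%R e))) // -wmapM mulVg addbb.
by congr Ext; case: e => /=; lia.
Qed.

Lemma ext_mulgV : right_inverse ext_one ext_inv ext_mul.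
Proof.
case=> w k e; rewrite /ext_mul /ext_inv /act /= -wmap_comp addbb.
rewrite (@eq_wmap _ _ id) ?wmap_id ?mulgV.
  by congr Ext; case: e => /=; lia.
by move=> x; rewrite /aff /=; case: e => /=; rewrite ?GRing.rmorphN /=; ring.
Qed.

HB.instance Definition _ := isGroup.Build ext
  ext_mulA ext_mul1g ext_mulg1 ext_mulVg ext_mulgV.

Lemma ext_eq g h : ext_w g = ext_w h -> ext_k g = ext_k h -> ext_e g = ext_e h -> g = h.
Proof. by case: g h => ? ? ? [? ? ?] /= -> -> ->. Qed.

Lemma ext_wM g h : ext_w (g * h) = act g (ext_w h). Proof. by []. Qed.
Lemma ext_kM g h : ext_k (g * h) = (ext_k g + sg (ext_e g) (ext_k h))%R. Proof. by []. Qed.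
Lemma ext_eM g h : ext_e (g * h) = ext_e g (+) ext_e h. Proof. by []. Qed.
Lemma actM g h w : act (g * h) w = act g (act h w). Proof. exact: act_ext_mul. Qed.
Lemma act1 w : act 1 w = w. Proof. exact: act_one. Qed.

Lemma ext_eV g : ext_e g^-1 = ext_e g. Proof. by []. Qed.

Lemma aff_inj g : injective (aff g).
Proof.
move=> x y /GRing.addrI; case: (ext_e g) => // /(congr1 (@GRing.opp _)).
by rewrite !GRing.opprK.
Qed.

Definition turn k : ext := Ext 1 k false.
Definition cox_ext w : ext := Ext w 0 false.

Lemma wmap_turn0 h w : ext_e h = false -> ((ext_k h)%:~R = 0 :> X)%R -> wmap (aff h) w = w.
Proof.
move=> e0 k0; rewrite (@eq_wmap _ _ id) ?wmap_id // => x.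
by rewrite /aff e0 k0 GRing.add0r.
Qed.

Lemma cox_extM u v : cox_ext (u * v) = cox_ext u * cox_ext v.
Proof. by apply: ext_eq; rewrite //= /act wmap_turn0. Qed.

Lemma cox_ext1 : cox_ext 1 = 1. Proof. by []. Qed.

Lemma cox_extV u : cox_ext u^-1 = (cox_ext u)^-1.
Proof. by apply: (mulgI (cox_ext u)); rewrite -cox_extM !mulgV. Qed.

Lemma zpow_turn k i : zpow (turn k) i = turn (i * k)%R.
Proof.
have rotS j : turn k * turn (j * k)%R = turn ((j + 1) * k)%R by apply: ext_eq => //=; lia.
elim/int_ind: i => [|i IH|i IH].
- by apply: ext_eq; rewrite //= GRing.mul0r.
- have -> : (i.+1%:Z = i%:Z + 1)%R by lia.
  by rewrite zpowS IH rotS.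
- apply: (mulgI (turn k)); rewrite -zpowS rotS.
  by have -> : (- i.+1%:Z + 1 = - i%:Z)%R by lia.
Qed.

(** Translation by a multiple of [m] is trivial on Z/m, hence on W; an element of sign - would
    invert the turn. *)
Lemma turn_dvd_commute g k : (1 < m)%N -> ext_e g = false -> (m %| k)%Z -> commute (turn k) g.
Proof.
move=> m_gt1 ge mk; apply: ext_eq => /=; rewrite ?ge //=; last by lia.
by rewrite /act /= mul1g mulg1 wmap_turn0 //; apply/intr_Zp_eq0.
Qed.

(** * Axes and eventual translations *)

Section Axis.
Variables (g : ext) (p : nat -> X) (L : nat).

(** The ray [p] starts at 1 in the Cayley tree, and [g] maps it into itself, advancing by [L]. *)
Definition axis := [/\ ray p, (0 < L)%N & forall j, act g (pre p j) = pre p (L + j)].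

Hypothesis gpL : axis.

Lemma axis_pow N j : act (g ^+ N) (pre p j) = pre p (N * L + j).
Proof.
case: gpL => _ _ gP; elim: N j => [|N IH] j; first by rewrite act1.
by rewrite expgS actM IH gP mulSn addnA.
Qed.

Lemma axis_pow_w N : ext_w (g ^+ N) = pre p (N * L).
Proof. by have := axis_pow N 0; rewrite addn0 /act wmap1 mulg1. Qed.

(** Geometrically, [h] fixes the end of the tree defined by [p] and moves towards it by [l]; the
    offsets skip an initial piece where [h] may leave the ray. *)
Definition shifts h (l : int) := exists a b,
  l = (b%:Z - a%:Z)%R /\ forall j, act h (pre p (a + j)) = pre p (b + j).

Lemma shifts_fun h l l' : shifts h l -> shifts h l' -> l = l'.
Proof.
case: gpL => pP _ _ [a [b [-> ab]]] [a' [b' [-> ab']]].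
have /(congr1 (fun w : W => size w)) : pre p (b + a') = pre p (b' + a) by rewrite -ab -ab' addnC.
by rewrite !size_pre //; lia.
Qed.

Lemma shiftsM h h' l l' : shifts h l -> shifts h' l' -> shifts (h * h') (l + l')%R.
Proof.
move=> [a [b [-> ab]]] [a' [b' [-> ab']]].
exists (a' + a)%N, (b + b')%N; split=> [|j]; first by lia.
by rewrite actM -addnA ab' addnCA ab addnA.
Qed.

Lemma shifts_axis : shifts g L.
Proof. by case: gpL => _ _ gP; exists 0%N, L; split=> //; lia. Qed.

Lemma shifts_turn k : (1 < m)%N -> (m %| k)%Z -> shifts (turn k) 0.
Proof.
move=> m_gt1 mk; exists 0%N, 0%N; split=> // j.
by rewrite /act /= mul1g wmap_turn0 //; apply/intr_Zp_eq0.
Qed.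

(** The image of [p] under [h] is eventually a ray [q]. As [h] commutes with all [g ^+ N],
    arbitrarily far points of this image lie at distance [size (ext_w h)] from [p], and diverging
    rays do not stay that close. *)
Lemma shifts_commute h : commute h g -> exists l, shifts h l.
Proof.
case: gpL => pP L_gt0 gP hg.
have affP f : ray (aff f \o p) by move=> i /=; rewrite (inj_eq (@aff_inj f)).
have [q [a [b [qP E]]]] := ray_mul (ext_w h) (affP h).
have hpq j : act h (pre p (a + j)) = pre q (b + j) by rewrite /act wmap_pre.
suff pq : q =1 p.
  exists (b%:Z - a%:Z)%R, a, b; split=> // j; rewrite hpq; apply: eq_pre => i _.
  exact: pq.
move=> i; apply/eqP/negP => /negP; rewrite eq_sym => pqi.
(* Large enough for [ray_diverge] to force a distance above [size (ext_w h)], which by [hgN] is the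
   exact distance. *)
pose N := (a + i + size (ext_w h)).+1; have NL : (N <= N * L)%N by rewrite leq_pmulr.
have Na : (N * L = a + (N * L - a))%N by rewrite subnKC //; lia.
have hgN : act h (pre p (N * L)) = act (g ^+ N) (ext_w h).
  by rewrite -axis_pow_w -!ext_wM (commuteX N hg).
have := ray_diverge qP pP (_ : q i != p i) (_ : i < N * L)%N (_ : i < b + (N * L - a))%N.
rewrite eq_sym pqi -hpq -Na hgN => /(_ isT ltac:(lia) ltac:(lia)).
rewrite {1}/act axis_pow_w mulKg wmap_seq; last exact: aff_inj.
by rewrite size_map; lia.
Qed.

(** With shift 0, [h] fixes two successive prefixes, so [aff h] fixes the letter [p a] between them.
    The translation is then trivial on Z/m, and the word of [h] is empty. *)
Lemma shifts0 h : (1 < m)%N -> ext_e h = false -> shifts h 0 -> exists2 k, (m %| k)%Z & h = turn k.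
Proof.
case: gpL => pP _ _ m_gt1 he [a [b [ab hp]]]; have {ab} ? : a = b by lia.
subst b; have := hp 0%N; have := hp 1%N.
rewrite addn1 addn0 preS /act wmapM mulgA => h1 h0.
move: h1; rewrite h0 => /mulgI; rewrite wmap_refl => -[].
rewrite /aff he => /(congr1 (fun y => y - p a)%R); rewrite GRing.addrK GRing.subrr => k0.
exists (ext_k h); first exact/intr_Zp_eq0.
apply: ext_eq => //=; move: h0; rewrite wmap_turn0 // => h0.
by apply: (mulIg (pre p a)); rewrite h0 mul1g.
Qed.

End Axis.

Definition hyperbolic g := exists c p L, axis ((cox_ext c)^-1 * g * cox_ext c) p L.

(** With d = [aff g], the axis is the infinite word w d(w) d(d(w)) ...; the condition on the last
    letter makes every junction reduced. *)
Lemma axis_of_cyclically_reduced g x s : cox_seq (ext_w g) = x :: s ->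
  last x s != aff g x -> exists p L, axis g p L.
Proof.
move=> wE lastx; pose w := x :: s; pose L := size w.
have ws : reduced w by rewrite /w -wE; case: (ext_w g).
(* Letter [i %% L] of block number [i %/ L]. *)
pose p i := iter (i %/ L) (aff g) (nth x w (i %% L)).
have pL i : p (L + i)%N = aff g (p i) by rewrite /p divnDl ?divnn ?modnDl.
have p_lt i : (i < L)%N -> p i = nth x w i by move=> iL; rewrite /p divn_small ?modn_small.
have pP : ray p.
  have step i : (i < L)%N -> p i != p i.+1.
    move=> iL; rewrite (p_lt i) //; case: (ltngtP i.+1 L) iL => // [iL _|iL _].
      by rewrite p_lt //; move/(sortedP x): ws => /(_ i iL).
    rewrite iL -[L]addn0 pL p_lt //=.
    by rewrite (_ : i = (size w).-1) ?nth_last // -/L -iL.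
  have stepM q r : (r < L)%N -> p (q * L + r)%N != p (q * L + r).+1.
    move=> rL; elim: q => [|q IH]; first exact: step.
    by rewrite mulSn -addnA -addnS !pL (inj_eq (@aff_inj g)).
  by move=> i; rewrite (divn_eq i L); apply/stepM/ltn_pmod.
exists p, L; split=> // j; rewrite /act wmap_pre pre_add; congr (_ * _).
  apply: cox_inj; rewrite wE pre_seq //.
  apply: (@eq_from_nth _ x) => [|i iL]; rewrite ?size_mkseq //.
  by rewrite nth_mkseq ?p_lt.
by apply: eq_pre => i _; rewrite pL.
Qed.

(** Induction on the length of the word: if its last letter is the image of the first, conjugation
    by the first letter removes both, unless the word is a single letter. *)
Lemma cyclic_reduction g : hyperbolic g \/ exists c : W,
  let h := (cox_ext c)^-1 * g * cox_ext c in
  ext_w h = 1 \/ exists2 x, ext_w h = refl x & aff h x = x.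
Proof.
move sz: (size (ext_w g)) => N; have {sz} : (size (ext_w g) <= N)%N by rewrite sz.
elim: N g => [|N IH] g.
  rewrite leqn0 => /nilP w0; right; exists 1; left; apply: cox_inj.
  by rewrite cox_ext1 invg1 mulg1 mul1g.
case wE: (cox_seq (ext_w g)) => [|x s] sN.
  right; exists 1; left; apply: cox_inj.
  by rewrite cox_ext1 invg1 mulg1 mul1g.
have [lastx|lastx] := eqVneq (last x s) (aff g x); last first.
  have [p [L gpL]] := axis_of_cyclically_reduced wE lastx.
  by left; exists 1, p, L; rewrite cox_ext1 invg1 mulg1 mul1g.
case/lastP: s => [|s y] in wE sN lastx *.
  right; exists 1; right; exists x; rewrite cox_ext1 invg1 mulg1 mul1g //.
  exact: cox_inj.
move: lastx; rewrite last_rcons => yE.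
have wP : reduced (x :: rcons s y) by rewrite -wE; case: (ext_w g).
have syP : reduced (rcons s y) by exact: path_sorted wP.
have sP : reduced s by move: syP; rewrite /reduced -cats1 => /cat_sorted2[].
have gw : ext_w g = refl x * (Cox sP * refl y).
  apply: cox_inj; rewrite wE refl_mulE cox_mulE /= ?cats1 //.
  by case: (rcons s y) wP => [//|z t] /= /andP[/negPf->].
have gE : cox_ext (refl x) * g * cox_ext (refl x) = Ext (Cox sP) (ext_k g) (ext_e g).
  apply: ext_eq => [||/=]; last by rewrite addbF.
    have -> : ext_w (cox_ext (refl x) * g * cox_ext (refl x))
        = refl x * (ext_w g * refl (aff g x)).
      by rewrite ext_wM actM /act wmap_turn0 // (wmap_refl (aff g)).
    by rewrite -yE gw -!mulgA reflK mulg1 mulgA reflK mul1g.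
  by rewrite !ext_kM /=; case: (ext_e g) => /=; lia.
have xV : (cox_ext (refl x))^-1 = cox_ext (refl x) by rewrite -cox_extV reflV.
have [|hyp|[c H]] := IH (cox_ext (refl x) * g * cox_ext (refl x)).
- by rewrite gE /=; move: sN; rewrite /= size_rcons; lia.
- left; move: hyp => [c [p [L gpL]]]; exists (refl x * c), p, L.
  by rewrite cox_extM invgM xV !mulgA; rewrite !mulgA in gpL.
right; exists (refl x * c); rewrite cox_extM invgM xV.
by move: H; cbv zeta; rewrite !mulgA.
Qed.

End Extended.

(** * Centralisers *)

Section Centralisers.
Variable m : nat.
Notation X := 'Z_m.
Notation W := (cox X).
Notation ext := (ext m).
Implicit Types (x : X) (u v w : W) (k : int) (g h : ext).

Lemma commute_conjV (G : groupType) (c h g : G) :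
  commute h g -> commute (c^-1 * h * c) (c^-1 * g * c).
Proof. by move=> hg; rewrite /commute !mulgA !mulgK -!(mulgA c^-1) hg. Qed.

Lemma conjV_mul (G : groupType) (c h g : G) :
  c^-1 * (h * g) * c = (c^-1 * h * c) * (c^-1 * g * c).
Proof. by rewrite !mulgA mulgK. Qed.

Lemma conjV_exp (G : groupType) (c h : G) N : c^-1 * h ^+ N * c = (c^-1 * h * c) ^+ N.
Proof. by elim: N => [|N IH]; rewrite ?mulg1 ?mulVg // !expgS conjV_mul IH. Qed.

Definition parity g := odd (size (ext_w g)) (+) odd (absz (ext_k g)).

Lemma parityM g h : parity (g * h) = parity g (+) parity h.
Proof.
rewrite /parity ext_wM ext_kM odd_size_mul wmap_seq ?size_map; last exact: aff_inj.
have -> : odd (absz (ext_k g + sg (ext_e g) (ext_k h))%R)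
      = odd (absz (ext_k g)) (+) odd (absz (ext_k h)).
  by rewrite /sg; case: (ext_e g); lia.
by rewrite -!addbA; congr (_ (+) _); rewrite addbCA.
Qed.

Lemma parity1 : parity 1 = false. Proof. by []. Qed.

Lemma parityV g : parity g^-1 = parity g.
Proof.
by have := parityM g g^-1; rewrite mulgV parity1; case: (parity g) (parity g^-1) => [] [].
Qed.

(** These elements turn out to be the image of the Artin group in E. *)
Definition even_plus g := ext_e g = false /\ parity g = false.

Lemma even_plus_conj c h : even_plus h -> even_plus (c * h * c^-1).
Proof.
case=> he hp; split; rewrite ?ext_eM ?parityM ?ext_eV ?parityV ?he ?hp.
  by case: (ext_e c).
by case: (parity c).
Qed.

Lemma commute_flip_k h y : ext_e h = true -> ext_e y = false -> commute y h ->
  ext_k y = 0%R.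
Proof. by move=> he ye /(congr1 (@ext_k m)); rewrite !ext_kM he ye /=; lia. Qed.

Hypothesis m_gt1 : (1 < m)%N.

Lemma conjV_turn c k : (m %| k)%Z -> (cox_ext c)^-1 * turn m k * cox_ext c = turn m k.
Proof. by move=> mk; rewrite -mulgA (turn_dvd_commute _ _ mk) ?mulKg. Qed.

(** The shift along the axis of a conjugate of [g], packaged as an additive length on the
    centraliser of [g]. Shifts are unique, so [xget] picks the right one. *)
Lemma hyperbolic_length g : hyperbolic g -> exists l : ext -> int,
  [/\ forall h h', commute h g -> commute h' g -> l (h * h') = (l h + l h')%R,
      forall h, commute h g -> ext_e h = false -> l h = 0%R -> exists2 k, (m %| k)%Z & h = turn m k,
      forall k, (m %| k)%Z -> l (turn m k) = 0%R &
      forall N, (0 < N)%N -> l (g ^+ N) <> 0%R].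
Proof.
case=> c [p [L gpL]]; have [_ L_gt0 _] := gpL.
pose cj h := (cox_ext c)^-1 * h * cox_ext c.
pose l h := xget 0%R (shifts p (cj h)).
have lP h n : shifts p (cj h) n -> l h = n.
  by move=> hn; rewrite /l; case: xgetP => [_ -> /(shifts_fun gpL)/(_ hn)|/(_ n)].
have lS h : commute h g -> shifts p (cj h) (l h).
  move=> /(commute_conjV (cox_ext c)) /(shifts_commute gpL) [n hn].
  by rewrite (lP _ _ hn).
have lM h h' : commute h g -> commute h' g -> l (h * h') = (l h + l h')%R.
  by move=> hg hg'; apply: lP; rewrite /cj conjV_mul; apply: (shiftsM (lS h hg) (lS h' hg')).
exists l; split=> // [h hg he l0|k mk|N N_gt0].
- have := lS h hg; rewrite l0 => /(shifts0 gpL m_gt1) [|k mk E].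
    by rewrite /cj !ext_eM ext_eV he.
  exists k => //; rewrite -(conjV_turn c mk) in E.
  exact/(mulgI (cox_ext c)^-1)/(mulIg (cox_ext c)).
- by apply: lP; rewrite /cj conjV_turn //; apply: shifts_turn.
have -> : l (g ^+ N) = Posz (N * L).
  elim: N N_gt0 => // N IH _; have [->|N_gt0] := posnP N.
    by rewrite mul1n; apply: lP; apply: shifts_axis.
  rewrite expgS lM ?IH //; last exact/commute_sym/commuteX.
  by rewrite (lP g L) ?mulSn //; apply: shifts_axis.
lia.
Qed.

(** Up to conjugation, [g ^+ N] has a nonempty reduced word; commuting with the turn by 2, which has
    even parity, would make its first letter invariant under translation by 2. *)
Lemma hyperbolic_infinite g N : (2 < m)%N -> hyperbolic g -> (0 < N)%N ->
  exists2 h, even_plus h & ~ commute (g ^+ N) h.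
Proof.
move=> m_gt2 [c [p [L gpL]]] N_gt0; pose s := turn m 2.
exists (cox_ext c * s * (cox_ext c)^-1); first exact: even_plus_conj.
move=> /(commute_conjV (cox_ext c)); rewrite conjV_exp !mulgA mulgVK mulVg mul1g.
set g' := _ * g * _ in gpL *; case: (gpL) => pP L_gt0 _.
move/(congr1 (@ext_w m)); rewrite !ext_wM /act (axis_pow_w gpL).
change (ext_w s) with (1 : W); rewrite mul1g wmap1 mulg1.
have [M NL] : exists M, (N * L = M.+1)%N by exists (N * L).-1; lia.
rewrite NL => /(congr1 (@cox_seq _)). rewrite wmap_seq ?pre_seq //.
rewrite mkseq_cons => /(congr1 (head (p 0%N))) /= E.
have : ((2 : int)%:~R = 0 :> X)%R.
  by move: E; rewrite /aff /= => E; apply: (GRing.addIr (p 0%N)); rewrite -E GRing.add0r.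
by move/(intr_Zp_eq0 _ m_gt1) => /dvdn_leq; move/(_ isT); rewrite leqNgt m_gt2.
Qed.

(** In the Cayley tree the conjugate fixes a vertex in the first case and inverts an edge in the
    second. *)
Definition elliptic c g := let h := (cox_ext c)^-1 * g * cox_ext c in
  ext_w h = 1 \/ exists2 x, ext_w h = refl x & aff h x = x.

(** In both cases the square of the conjugate is a turn, so its [m]-th power is a turn by a multiple
    of [m], which conjugation by W leaves unchanged. *)
Lemma elliptic_finite c g : elliptic c g -> exists2 k, (m %| k)%Z & g ^+ (2 * m) = turn m k.
Proof.
rewrite /elliptic; set h := _ * g * _; cbv zeta => H.
have [k hk] : exists k, h ^+ 2 = turn m k.
  have hh : ext_w (h * h) = 1.
    case: H => [hw|[x hw hx]]; rewrite ext_wM /act hw ?wmap1 ?mulg1 //.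
    by rewrite wmap_refl hx reflK.
  by exists (ext_k (h * h)); rewrite expg2; apply: ext_eq; rewrite ?hh // ext_eM addbb.
have gE : (cox_ext c)^-1 * g ^+ (2 * m) * cox_ext c = turn m (Posz m * k)%R.
  by rewrite conjV_exp -/h expgnA hk -zpow_turn.
exists (Posz m * k)%R; first exact: dvdz_mulr.
apply: (mulgI (cox_ext c)^-1); apply: (mulIg (cox_ext c)).
by rewrite gE conjV_turn //; apply: dvdz_mulr.
Qed.

(** If [v] does not start with [x], the right side is reduced, starts with [x] and is longer than
    [v]; so the left side is reduced and starts like [v], which forces [v] to be empty. Otherwise
    the same applies to [refl x * v]. *)
Lemma refl_mulr_refl_mull (f : X -> X) x z v : injective f -> f x = x ->
  v * refl z = refl x * wmap f v -> v = 1 \/ v = refl x.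
Proof.
move=> f_inj fx.
(* The default [x + 1] differs from [x], so the empty word counts as not starting with [x]. *)
have key u : head (x + 1)%R u != x -> u * refl z = refl x * wmap f u -> u = 1.
  move=> ux /(congr1 (fun w : W => cox_seq w)).
  have -> : u * refl z = (refl z * u^-1)^-1 by rewrite invgM invgK reflV.
  rewrite cox_inv_seq !refl_mulE cox_inv_seq wmap_seq //.
  have -> : push x (map f u) = x :: map f u.
    case: (cox_seq u) ux => [//|y s] /= yx; case: eqP => // xy.
    by case/eqP: yx; apply: f_inj; rewrite fx.
  case uE: (cox_seq u) => [|y s]; first by move=> _; apply: cox_inj.
  rewrite uE /= in ux; case E: (rev (y :: s)) => [|t r].
    by move/(congr1 size): E; rewrite size_rev.
  rewrite /push; case: eqP => _.
    move/(congr1 size)/eqP; rewrite size_rev /= size_map.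
    by have := congr1 size E; rewrite size_rev /=; lia.
  by rewrite -E rev_cons revK => -[yx]; rewrite yx eqxx in ux.
move=> E; have [vx|vx] := eqVneq (head (x + 1)%R v) x; last by left; apply: key.
right; have [s vE] : exists s, cox_seq v = x :: s.
  case: (cox_seq v) vx => [/= /eqP|y s /= ->]; last by exists s.
  by rewrite -GRing.subr_eq0 GRing.addrAC GRing.subrr GRing.add0r GRing.oner_eq0.
have xvs : cox_seq (refl x * v) = s by rewrite refl_mulE vE /= eqxx.
have xv1 : refl x * v = 1.
  apply: key; last by rewrite wmapM wmap_refl fx !mulgA reflK mul1g -mulgA E mulgA reflK mul1g.
  rewrite xvs; have := cox_reduced v; rewrite vE; case: s {vE xvs} => [|y s] /=.
    by rewrite -GRing.subr_eq0 GRing.addrAC GRing.subrr GRing.add0r GRing.oner_eq0.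
  by rewrite /reduced /= eq_sym => /andP[].
by rewrite -[v](mulKg (refl x)) xv1 mulg1 reflV.
Qed.

Section EvenModulus.
Hypothesis m_even : ~~ odd m.

Lemma dvd_even k : (m %| k)%Z -> odd (absz k) = false.
Proof. by case/dvdnP=> q ->; rewrite oddM (negPf m_even) andbF. Qed.

Lemma intr_eq_double_even k x : (k%:~R = x + x :> X)%R -> odd (absz k) = false.
Proof.
move=> kx; suff : odd (absz (k - (2 * val x)%N%:Z)%R) = false by lia.
apply/dvd_even/intr_Zp_eq0 => //; rewrite GRing.rmorphB /= kx mul2n -addnn.
by rewrite -[X in (_ - X)%R]/((x + x)%N%:R)%R GRing.natrD natr_Zp GRing.subrr.
Qed.

(** Commutation makes the word of [y] invariant under a translation that fixes no letter. *)
Lemma commute_turn h y : ext_w h = 1 -> ext_e h = false -> ~ (m %| ext_k h)%Z ->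
  ext_e y = false -> commute y h -> ext_w y = 1.
Proof.
move=> hw he mk ye /(congr1 (@ext_w m)); rewrite !ext_wM /act hw wmap1 mulg1 mul1g.
move/(congr1 (@cox_seq _)); rewrite wmap_seq; last exact: aff_inj.
case yE: (cox_seq (ext_w y)) => [|x s]; first by move=> _; apply: cox_inj.
move=> /= [E _]; case: mk; apply/(intr_Zp_eq0 _ m_gt1).
by move: E; rewrite /aff he => E; apply: (GRing.addIr x); rewrite -E GRing.add0r.
Qed.

(** For odd k the map x |-> k - x has no fixed point modulo an even number, so the word of [y] is
    empty; the sign of [h] kills the integer part. *)
Lemma commute_flip_odd h y : ext_w h = 1 -> ext_e h = true -> odd (absz (ext_k h)) ->
  ext_e y = false -> commute y h -> y = 1.
Proof.
move=> hw he hk ye yh; have yk := commute_flip_k he ye yh.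
apply: ext_eq => //; move/(congr1 (@ext_w m)): yh.
rewrite !ext_wM /act hw wmap1 mulg1 mul1g.
move/(congr1 (@cox_seq _)); rewrite wmap_seq; last exact: aff_inj.
case yE: (cox_seq (ext_w y)) => [|x s]; first by move=> _; apply: cox_inj.
move=> /= [E _]; move: hk; rewrite (@intr_eq_double_even _ x) //.
by rewrite [X in (X + _)%R]E /aff he GRing.subrK.
Qed.

(** The word of [y] is empty or the letter [x]. Either way [aff y] fixes [x], so [m] divides
    [ext_k y], and even parity leaves only the empty word. *)
Lemma commute_refl_conj h y x : ext_w h = refl x -> aff h x = x ->
  even_plus y -> commute y h -> exists2 k, (m %| k)%Z & y = turn m k.
Proof.
move=> hw hx [ye yp] /(congr1 (@ext_w m)); rewrite !ext_wM /act hw wmap_refl => E.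
have fixx : aff y x = x -> (m %| ext_k y)%Z.
  move=> yx; apply/(intr_Zp_eq0 _ m_gt1); move: yx; rewrite /aff ye => yx.
  by apply: (GRing.addIr x); rewrite yx GRing.add0r.
case: (refl_mulr_refl_mull (@aff_inj _ h) hx E) => yw.
  exists (ext_k y); last exact: ext_eq.
  by apply: fixx; move: E; rewrite yw wmap1 mul1g mulg1 => -[].
have /fixx/dvd_even yk : aff y x = x.
  by move: E; rewrite yw wmap_refl hx => /mulgI[].
by move: yp; rewrite /parity yk yw.
Qed.

(** Fixing [x] forces [ext_k h] to be 0 or 2x modulo the even number [m], hence even, while the word
    has one letter. *)
Lemma elliptic_refl_parity h x : ext_w h = refl x -> aff h x = x -> parity h = true.
Proof.
move=> hw hx; rewrite /parity hw /=; apply: negbT.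
move: hx; rewrite /aff; case: (ext_e h) => hx.
  by rewrite (@intr_eq_double_even _ x) // -[X in (_ = X + _)%R]hx GRing.subrK.
rewrite dvd_even //; apply/(intr_Zp_eq0 _ m_gt1).
by apply: (GRing.addIr x); rewrite hx GRing.add0r.
Qed.

End EvenModulus.

End Centralisers.

(** * Letters fixed by negation and the infinite dihedral group they generate *)

Section Flip.
Variable n : nat.
Hypothesis n_gt0 : (0 < n)%N.
Notation X := 'Z_(n.*2).

Definition flip : ext n.*2 := Ext 1 0 true.
Definition mid : X := (n%:R)%R.
(** Negation fixes exactly the letters 0 and n. Their reflections generate an infinite dihedral
    group, whose translations are the powers of this element. *)
Definition half_turn_word : cox X := refl 0%R * refl mid.

Let m_gt1 : (1 < n.*2)%N. Proof. lia. Qed.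

Lemma mid_neq0 : mid != 0%R.
Proof.
apply/eqP => /(congr1 val) /=; rewrite val_Zp_nat // modn_small; lia.
Qed.

Lemma oppr_mid : (- mid)%R = mid.
Proof.
apply/eqP; rewrite eq_sym -GRing.addr_eq0 -GRing.natrD addnn; apply/eqP; exact: pchar_Zp.
Qed.

Lemma oppr_fixed (x : X) : (- x)%R = x -> x = 0%R \/ x = mid.
Proof.
move=> xx; have : (((2 * val x)%N%:Z)%:~R = 0 :> X)%R.
  have -> : (2 * val x = val x + val x)%N by lia.
  by rewrite -[LHS]/((x + x)%N%:R)%R GRing.natrD natr_Zp -{1}xx GRing.addNr.
move/(intr_Zp_eq0 _ m_gt1) => /dvdnP[q /=].
have x_lt : (val x < n.*2)%N by have := ltn_ord x; rewrite {2}Zp_cast.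
rewrite /= in x_lt; case: q => [|[|q]] E; [left|right|exfalso; nia].
  by apply: val_inj => /=; lia.
by apply: val_inj; rewrite /= val_Zp_nat // modn_small; lia.
Qed.

Let zigzag i : X := if odd i then mid else 0%R.

Lemma half_turn_word_exp k : half_turn_word ^+ k = pre zigzag k.*2.
Proof.
elim: k => [//|k IH]; rewrite expgSr IH doubleS !preS /half_turn_word -mulgA.
by rewrite /zigzag /= odd_double.
Qed.

Lemma half_turn_word_inf i : zpow half_turn_word i = 1 -> i = 0%R.
Proof.
have zzP : ray zigzag.
  by move=> j; rewrite /zigzag /=; case: odd; rewrite // ?mid_neq0 // eq_sym mid_neq0.
have inf k : half_turn_word ^+ k = 1 -> k = 0%N.
  rewrite half_turn_word_exp => /(congr1 (fun w : cox X => size w)).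
  by rewrite size_pre //; case: k.
case: i => k /=; first by move/inf->.
by move=> /eqP; rewrite invg_eq1 => /eqP/inf.
Qed.

(** Neighbouring letters differ, so a word of even length in 0 and n splits into pairs s_0 s_n and
    s_n s_0, which are mutually inverse. *)
Lemma half_turn_word_gen (v : cox X) : (forall x, x \in cox_seq v -> (- x)%R = x) ->
  ~~ odd (size v) -> exists i, v = zpow half_turn_word i.
Proof.
case: v => s sP /=; have [N] : exists N, (size s <= N)%N by exists (size s).
elim: N s sP => [|N IH] [|x [|y s]] sP //=; try by exists 0%R; apply: cox_inj.
rewrite ltnS negbK => sN fixs sodd.
have sP' : reduced s by exact: path_sorted (path_sorted sP).
have [||i si] := IH s sP' (ltnW sN).
- by move=> z zs; apply: fixs; rewrite !inE zs !orbT.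
- by [].
rewrite (cox_cons sP (path_sorted sP)) (cox_cons _ sP') si mulgA.
have xy : x != y by case/andP: sP.
case: (@oppr_fixed x); case: (@oppr_fixed y); rewrite ?fixs ?inE ?eqxx ?orbT //.
all: move=> yE xE; move: xy; rewrite xE yE ?eqxx // => _.
  by exists (i + 1)%R; rewrite zpowS.
exists (i - 1)%R; rewrite GRing.addrC zpowD zpowN zpow1; congr (_ * _).
by rewrite /half_turn_word invgM !reflV.
Qed.

End Flip.

(** * Embedding of the Artin group *)

Section Embedding.
Variable n : nat.
Hypothesis n_gt0 : (0 < n)%N.
Notation A := (artin n).
Notation a := (art_a n).
Notation b := (art_b n).
Notation X := 'Z_(n.*2).
Notation ext := (ext n.*2).

Let m_gt1 : (1 < n.*2)%N. Proof. lia. Qed.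

Lemma artin_ind (P : A -> Prop) : P a -> P b -> (forall x y, P x -> P y -> P (x * y)) ->
  (forall x, P x -> P x^-1) -> forall x, P x.
Proof.
move=> Pa Pb PM PV x; rewrite -(word_reprK x) -word_eval_gen.
elim: (word_repr x) => [|[y s] w IH]; first by rewrite /= -(mulgV a); apply/PM/PV.
apply: PM => //; rewrite /letter_eval /=.
by case: s y => [] []; do ?apply: PV.
Qed.

(* [sh], [sh * flip n] and [flip n] realise sigma, iota and sigma iota by conjugation. *)
Definition sh : ext := cox_ext (refl 0%R).
Definition st : ext := turn n.*2 1.

Lemma sh2 : sh * sh = 1. Proof. by rewrite -cox_extM reflK. Qed.
Lemma shV : sh^-1 = sh. Proof. by rewrite -cox_extV reflV. Qed.

Definition emb_gen (x : bool) : ext := if x then st * sh else sh * st.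

Lemma turn_conj (w : cox X) k : (n.*2 %| k)%Z ->
  cox_ext w * turn _ k * (cox_ext w)^-1 = turn _ k.
Proof. by move=> mk; rewrite -(turn_dvd_commute m_gt1 _ mk) ?mulgK. Qed.

Lemma st_exp k : st ^+ k = turn _ k.
Proof. by have := zpow_turn n.*2 1 k; rewrite GRing.mulr1. Qed.

(** The two sides become the turn by 2n and its conjugate by [sh], equal because translation by 2n
    is trivial on Z/2n. *)
Lemma emb_rel u v : artin_rel n u v -> word_eval emb_gen u = word_eval emb_gen v.
Proof.
case=> -> ->; rewrite !word_eval_flatten /= /letter_eval /= !mulg1.
have -> : st * sh * (sh * st) = st ^+ 2 by rewrite mulgA -(mulgA st) sh2 mulg1.
have -> : sh * st * (st * sh) = sh^-1^-1 * st ^+ 2 * sh^-1 by rewrite invgK shV !mulgA.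
rewrite -conjV_exp -expgnA st_exp invgK turn_conj //.
by apply/dvdzP; exists 1%R; lia.
Qed.

Definition emb : A -> ext := pres_lift emb_gen.

Lemma embM : {morph emb : x y / x * y}. Proof. exact: (pres_liftM emb_rel). Qed.
Lemma emb_a : emb a = st * sh. Proof. exact: (pres_lift_gen emb_rel true). Qed.
Lemma emb_b : emb b = sh * st. Proof. exact: (pres_lift_gen emb_rel false). Qed.

Lemma emb1 : emb 1 = 1. Proof. by apply: (mulgI (emb 1)); rewrite -embM !mulg1. Qed.

Lemma embV x : emb x^-1 = (emb x)^-1.
Proof. by apply: (mulgI (emb x)); rewrite -embM !mulgV emb1. Qed.

Lemma embX x k : emb (x ^+ k) = emb x ^+ k.
Proof. by elim: k => [|k IH]; rewrite ?emb1 // !expgS embM IH. Qed.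

Lemma emb_ab : emb (a * b) = st ^+ 2.
Proof. by rewrite embM emb_a emb_b mulgA -(mulgA st) sh2 mulg1. Qed.

Lemma emb_ba : emb (b * a) = sh * st ^+ 2 * sh.
Proof. by rewrite embM emb_a emb_b !mulgA. Qed.

Lemma emb_Delta : emb (Delta n) = turn _ n.*2.
Proof. by rewrite /Delta embX emb_ab -expgnA st_exp; congr turn; lia. Qed.

Lemma emb_sigma x : emb (art_sigma n x) = sh * emb x * sh^-1.
Proof.
have sM : {morph (fun y => emb (art_sigma n y)) : y z / y * z}.
  by move=> y z; rewrite aut_mulM embM.
have cM : {morph (fun y => sh * emb y * sh^-1) : y z / y * z}.
  by move=> y z; rewrite embM !mulgA mulgVK.
apply: (artin_ext sM cM); rewrite shV /=.
  by rewrite sigma_fun_a emb_a emb_b -!mulgA sh2 mulg1.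
by rewrite sigma_fun_b emb_a emb_b !mulgA sh2 mul1g.
Qed.

Notation fl := (flip n).

Lemma fl2 : fl * fl = 1. Proof. exact: ext_eq. Qed.
Lemma flV : fl^-1 = fl. Proof. by apply: (mulgI fl); rewrite mulgV; apply/esym/fl2. Qed.

Lemma fl_sh : fl * sh = sh * fl.
Proof.
apply: ext_eq => //; rewrite !ext_wM /act /= wmap_refl mul1g mulg1; congr refl.
by rewrite /aff /= GRing.oppr0 GRing.addr0.
Qed.

Lemma fl_st : fl * st = st^-1 * fl. Proof. exact: ext_eq. Qed.

Lemma emb_iota x : emb (art_iota n x) = (sh * fl) * emb x * (sh * fl)^-1.
Proof.
have sM : {morph (fun y => emb (art_iota n y)) : y z / y * z}.
  by move=> y z; rewrite aut_mulM embM.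
have cM : {morph (fun y => (sh * fl) * emb y * (sh * fl)^-1) : y z / y * z}.
  by move=> y z; rewrite embM; move: (sh * fl) => c; rewrite !mulgA mulgVK.
apply: (artin_ext sM cM); rewrite /= invgM shV flV.
  rewrite iota_fun_a embV emb_a invgM shV -!mulgA fl_sh (mulgA sh sh) sh2 mul1g.
  by rewrite (mulgA fl st) fl_st -mulgA fl2 mulg1.
rewrite iota_fun_b embV emb_b invgM shV -!mulgA (mulgA fl sh) fl_sh -!mulgA.
by rewrite (mulgA sh sh) sh2 mul1g (mulgA fl st) fl_st -mulgA -fl_sh (mulgA fl fl) fl2 mul1g.
Qed.

Lemma even_plus_emb x : even_plus (emb x).
Proof.
elim/artin_ind: x => [||x y [xe xp] [ye yp]|x [xe xp]].
- by rewrite emb_a.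
- by rewrite emb_b.
- by rewrite embM; split; rewrite ?ext_eM ?parityM ?xe ?ye ?xp ?yp.
- by rewrite embV; split; rewrite ?ext_eV ?parityV.
Qed.

(* The elements of [ext] with positive sign act on the set [A], with [sh] acting
   as sigma and [st] as [h |-> a * sigma h]; then [emb x] acts as left
   multiplication by [x], which makes [emb] injective. *)
Section EmbAction.
Implicit Types (h t : A) (i j k : int).

Definition stA h : A := a * sigma_fun h.
Definition stVA h : A := sigma_fun (a^-1 * h).

Lemma stAK : cancel stA stVA.
Proof. by move=> h; rewrite /stVA /stA mulKg sigma_funK. Qed.

Lemma stVAK : cancel stVA stA.
Proof. by move=> h; rewrite /stVA /stA sigma_funK mulVKg. Qed.

Definition stZ k h : A :=
  match k with Posz l => iter l stA h | Negz l => iter l.+1 stVA h end.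

Lemma stZS k h : stZ (k + 1)%R h = stA (stZ k h).
Proof.
case: k => l; first by rewrite -PoszD addn1.
have -> : (Negz l + 1 = - l%:Z)%R by lia.
by case: l => [|l]; rewrite /= stVAK.
Qed.

Lemma stZD i j h : stZ (i + j)%R h = stZ i (stZ j h).
Proof.
elim/int_ind: i => [|k IH|k IH]; first by rewrite GRing.add0r.
  have -> : (k.+1%:Z + j = (k%:Z + j) + 1)%R by lia.
  have -> : (k.+1%:Z = k%:Z + 1)%R by lia.
  by rewrite !stZS IH.
apply: (can_inj stAK); rewrite -!stZS.
have -> : (- k.+1%:Z + j + 1 = - k%:Z + j)%R by lia.
by have -> : (- k.+1%:Z + 1 = - k%:Z)%R by lia.
Qed.

(** Two steps [stA] are left multiplication by ab, so 2n steps are left multiplication by [Delta n],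
    which sigma fixes. This makes [reflA] independent of the integer representing a residue. *)
Lemma stZ_sigma k h : (n.*2 %| k)%Z -> stZ k (sigma_fun h) = sigma_fun (stZ k h).
Proof.
have st2 t : stA (stA t) = a * b * t.
  by rewrite /stA sigma_morph sigma_funK sigma_fun_a mulgA.
have stm t : stZ n.*2 t = Delta n * t.
  rewrite /stZ /Delta; suff iterE l : iter l.*2 stA t = (a * b) ^+ l * t by exact: iterE.
  elim: l => [|l IH]; first by rewrite mul1g.
  by rewrite doubleS !iterS IH st2 expgS mulgA.
have sD : sigma_fun (Delta n) = Delta n.
  have sX l (t : A) : sigma_fun (t ^+ l) = sigma_fun t ^+ l.
    elim: l => [|l IH]; last by rewrite !expgS sigma_morph IH.
    by apply: (mulgI (sigma_fun 1)); rewrite -sigma_morph !mulg1.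
  by rewrite /Delta sX sigma_morph sigma_fun_a sigma_fun_b artin_relE.
have CV i : (forall t, stZ i (sigma_fun t) = sigma_fun (stZ i t)) ->
    forall t, stZ (- i)%R (sigma_fun t) = sigma_fun (stZ (- i)%R t).
  move=> Ci t; have iK u : stZ (- i)%R (stZ i u) = u by rewrite -stZD GRing.addNr.
  have iVK u : stZ i (stZ (- i)%R u) = u by rewrite -stZD GRing.addrN.
  by rewrite -[RHS]iK Ci iVK.
have Cm t : stZ n.*2 (sigma_fun t) = sigma_fun (stZ n.*2 t).
  by rewrite !stm -{1}sD sigma_morph.
have Cq q t : stZ (Posz q * n.*2)%R (sigma_fun t) = sigma_fun (stZ (Posz q * n.*2)%R t).
  elim: q t => [|q IH] t; first by rewrite GRing.mul0r.
  have -> : (q.+1%:Z * n.*2 = q%:Z * n.*2 + n.*2)%R by lia.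
  by rewrite !stZD Cm IH.
case/dvdzP=> -[q|q] ->; first exact: Cq.
have -> : (Negz q * n.*2 = - (q.+1%:Z * n.*2))%R by lia.
exact/CV/Cq.
Qed.

(** Models the identity s_x = st^x sh st^(-x) in E. *)
Definition reflA (x : X) h : A := stZ (val x) (sigma_fun (stZ (- (val x)%:Z)%R h)).

Lemma reflAK x : involutive (reflA x).
Proof.
move=> h; rewrite /reflA -(stZD (- _)) GRing.addNr [stZ 0 _]/= sigma_funK.
by rewrite -stZD GRing.addrN.
Qed.

Lemma reflAE k h : reflA (k%:~R)%R h = stZ k (sigma_fun (stZ (- k)%R h)).
Proof.
rewrite /reflA; set x : X := (k%:~R)%R.
have mk : (n.*2 %| (Posz (val x) - k)%R)%Z.
  apply/(intr_Zp_eq0 _ m_gt1); rewrite GRing.rmorphB /=.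
  by rewrite -[X in (X - _)%R]/((val x)%:R)%R natr_Zp GRing.subrr.
have -> : Posz (val x) = (k + ((val x)%:Z - k))%R by lia.
move: ((val x)%:Z - k)%R mk => d mk.
by rewrite stZD stZ_sigma // -stZD; congr (stZ _ (sigma_fun (stZ _ _))); lia.
Qed.

Definition eact (y : ext) h : A := cact reflA (ext_w y) (stZ (ext_k y) h).

Lemma eact_sh y h : eact (sh * y) h = sigma_fun (eact y h).
Proof.
rewrite /eact ext_kM GRing.add0r ext_wM /act wmap_turn0 // (cactM_mul reflAK).
exact: (reflAE 0).
Qed.

(** Moving [st] past the word raises each letter by 1; [reflAE] absorbs the wraparound modulo 2n. *)
Lemma eact_st y h : eact (st * y) h = stA (eact y h).
Proof.
rewrite /eact ext_kM ext_wM /act mul1g.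
rewrite [(_ + _)%R]GRing.addrC -[ext_k st]/1%R -[sg _ _]/(ext_k y) stZS.
move: (stZ _ h) => t; elim/cox_ind: (ext_w y) => [|x w IH]; first by [].
rewrite wmapM wmap_refl !(cactM_mul reflAK) IH /cact /=.
move: (foldr _ _ _) => u; rewrite /aff /=.
have -> : (1%:~R + x = (1 + (val x)%:Z)%:~R)%R.
  by rewrite GRing.rmorphD /= -[X in (_ = _ + X)%R]/((val x)%:R)%R natr_Zp.
rewrite reflAE /reflA (GRing.addrC 1%R (Posz _)) stZS; move: (val x) => v.
congr (stA (stZ _ (sigma_fun _))).
by rewrite -[stA u]/(stZ 1 u) -stZD; congr stZ; lia.
Qed.

Lemma eact_emb x y h : ext_e y = false -> eact (emb x * y) h = x * eact y h.
Proof.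
have main z : eact (emb x * z) h = x * eact z h; last by [].
elim/artin_ind: x z => [||x y' xP yP|x xP] z.
- by rewrite emb_a -mulgA eact_st eact_sh /stA sigma_funK.
- by rewrite emb_b -mulgA eact_sh eact_st /stA sigma_morph sigma_fun_a sigma_funK.
- by rewrite embM -mulgA xP yP mulgA.
- by apply: (mulgI x); rewrite mulVKg -xP mulgA embV mulgV mul1g.
Qed.

End EmbAction.

Lemma emb_inj : injective emb.
Proof.
move=> x y xy; apply: (mulIg (eact 1 1)).
by rewrite -!eact_emb // xy.
Qed.

(** The union [T] of the image and its right coset by [sh] is stable under left multiplication by
    [sh], [st] and the inverse of [st], so it contains all elements of sign +. Parity excludes the
    coset. *)
Lemma emb_surj y : even_plus y -> exists x, emb x = y.
Proof.
case=> ye yp; pose T := [set z | exists x, z = emb x \/ z = emb x * sh].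
have Tsh z : T z -> T (sh * z).
  move=> [x [->|->]]; exists (art_sigma n x); [right|left]; rewrite emb_sigma.
    by rewrite mulgVK.
  by rewrite shV mulgA.
have Temb z x : T z -> T (emb x * z).
  by move=> [x' [->|->]]; exists (x * x'); [left|right]; rewrite embM ?mulgA.
have stE : st = sh * emb b by rewrite emb_b mulgA sh2 mul1g.
have Tst z : T z -> T (st * z) by move=> Tz; rewrite stE -mulgA; apply/Tsh/Temb.
have TstV z : T z -> T (st^-1 * z).
  by move=> Tz; rewrite stE invgM shV -embV -mulgA; apply/Temb/Tsh.
have Tturn k z : T z -> T (turn _ k * z).
  rewrite -[k]GRing.mulr1 -zpow_turn => Tz.
  elim/int_ind: k => [|k IH|k IH]; first by rewrite mul1g.
    have -> : (k.+1%:Z = k%:Z + 1)%R by lia.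
    by rewrite zpowS -mulgA; apply: Tst.
  have -> : (- k.+1%:Z = -1 + - k%:Z)%R by lia.
  by rewrite zpowD (zpowN _ 1%R) zpow1 -mulgA; apply: TstV.
have Tw (w : cox X) z : T z -> T (cox_ext w * z).
  move=> Tz; elim/cox_ind: w => [|x w IH]; first by rewrite cox_ext1 mul1g.
  rewrite cox_extM -mulgA.
  have -> : cox_ext (refl x) = turn _ (val x) * (sh * turn _ (- (val x)%:Z)%R).
    apply: ext_eq => //=; last by lia.
    rewrite /act /= mulg1 mul1g wmap_refl; congr refl; rewrite /aff /= GRing.addr0.
    by rewrite -[RHS]/((val x)%:R)%R natr_Zp.
  by rewrite -!mulgA; apply/Tturn/Tsh/Tturn.
have : T y.
  have -> : y = cox_ext (ext_w y) * (turn _ (ext_k y) * 1).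
    rewrite mulg1; apply: ext_eq; rewrite ?ye //; last by rewrite /= GRing.add0r.
    by rewrite ext_wM /act wmap1 mulg1.
  by apply/Tw/Tturn; exists 1; left; rewrite emb1.
case=> x [->|yE]; first by exists x.
by have [_ xp] := even_plus_emb x; move: yp; rewrite yE parityM xp.
Qed.

End Embedding.

(** * Fixed subgroups *)

Section GammaNormalForm.
Variable n : nat.
Notation A := (artin n).

Lemma aut_mul_inner (G : groupType) (f : aut G) g : f * inner g = inner (f g) * f.
Proof.
have fV x : f x^-1 = (f x)^-1.
  have f1 : f 1 = 1 by apply: (mulgI (f 1)); rewrite -aut_mulM !mulg1.
  by apply: (mulgI (f x)); rewrite -aut_mulM !mulgV f1.
by apply: aut_eq => x; rewrite !aut_mulE /= /inner_fun !aut_mulM fV.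
Qed.

Lemma innerM (G : groupType) (g h : G) : inner (g * h) = inner g * inner h.
Proof. by apply: aut_eq => x; rewrite aut_mulE /= /inner_fun invgM !mulgA. Qed.

Lemma inner1 (G : groupType) : inner (1 : G) = 1.
Proof. by apply: aut_eq => x; rewrite /= /inner_fun invg1 mulg1 mul1g. Qed.

Lemma innerV (G : groupType) (g : G) : inner g^-1 = (inner g)^-1.
Proof. by apply: (mulgI (inner g)); rewrite -innerM !mulgV inner1. Qed.

Lemma sigma2 : art_sigma n * art_sigma n = 1.
Proof. by apply: aut_eq => x; apply: sigma_funK. Qed.

Lemma iota2 : art_iota n * art_iota n = 1.
Proof. by apply: aut_eq => x; apply: iota_funK. Qed.

Lemma iota_sigma : art_iota n * art_sigma n = art_sigma n * art_iota n.
Proof.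
have sV x : sigma_fun x^-1 = (sigma_fun x)^-1 :> A.
  have s1 : sigma_fun (1 : A) = 1.
    by apply: (mulgI (sigma_fun 1)); rewrite -sigma_morph !mulg1.
  by apply: (mulgI (sigma_fun x)); rewrite -sigma_morph !mulgV s1.
apply: aut_eq; apply: artin_ext => [||/=|/=]; try exact: aut_mulM.
  by rewrite sigma_fun_a iota_fun_b iota_fun_a sV sigma_fun_a.
by rewrite sigma_fun_b iota_fun_b iota_fun_a sV sigma_fun_b.
Qed.

(** The normal forms are closed under products because f phi_g = phi_(f g) f for every automorphism
    f, and sigma and iota are commuting involutions. *)
Lemma AutGamma_form gamma : AutGamma n gamma -> exists g : A,
  [\/ gamma = inner g, gamma = inner g * art_iota n,
      gamma = inner g * art_sigma n | gamma = inner g * (art_sigma n * art_iota n)].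
Proof.
pose al (d e : bool) : aut A := art_sigma n ^+ d * art_iota n ^+ e.
have alM d e d' e' : al d e * al d' e' = al (d (+) d') (e (+) e').
  have iX (x : aut A) : x * x = 1 -> forall c c' : bool, x ^+ c * x ^+ c' = x ^+ (c (+) c').
    by move=> x2 [] []; rewrite ?mulg1 ?mul1g // x2.
  rewrite /al mulgA -(mulgA (_ ^+ d)) (commute_sym (commuteX2 d' e (commute_sym iota_sigma))).
  by rewrite mulgA (iX _ sigma2) -mulgA (iX _ iota2).
have al1 : al false false = 1 by rewrite /al mulg1.
move/(_ [set f | exists g d e, f = inner g * al d e]); case=> [||g [d [e ->]]].
- split=> [|_ _ [g [d [e ->]]] [g' [d' [e' ->]]]|_ [g [d [e ->]]]].
  + by exists 1, false, false; rewrite al1 mulg1 inner1.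
  + exists (g * al d e g'), (d (+) d'), (e (+) e').
    by rewrite -mulgA (mulgA (al d e)) aut_mul_inner innerM -alM !mulgA.
  + have alV : (al d e)^-1 = al d e.
      by apply: (mulgI (al d e)); rewrite mulgV alM !addbb al1.
    by exists (al d e g^-1), d, e; rewrite invgM alV -innerV aut_mul_inner.
- move=> _ [[g _ <-]|[->|->]].
  + by exists g, false, false; rewrite al1 mulg1.
  + by exists 1, true, false; rewrite inner1 mul1g /al mulg1.
  + by exists 1, false, true; rewrite inner1 mul1g /al mul1g.
exists g; case: d e => [] []; rewrite /al ?expg1 ?expg0 ?mul1g ?mulg1.
- exact: Or44.
- exact: Or43.
- exact: Or42.
- exact: Or41.
Qed.

End GammaNormalForm.

Lemma cyclic_subV (G : groupType) (g : G) : cyclic_sub g^-1 = cyclic_sub g.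
Proof.
have sub (x : G) : cyclic_sub x^-1 `<=` cyclic_sub x.
  rewrite [X in X `<=` _]cyclic_subE => _ [i _ <-].
  apply: (@subgroup_zpow _ (cyclic_sub x)); first exact: cyclic_sub_subgroup.
  by rewrite cyclic_subE; exists (- (1))%R; rewrite // zpowN.
by apply/seteqP; split; [|rewrite -{1}[g]invgK]; apply: sub.
Qed.

Lemma fixed_sub_subgroup (G : groupType) (f : aut G) : is_subgroup (fixed_sub f).
Proof.
have f1 : f 1 = 1 by apply: (mulgI (f 1)); rewrite -aut_mulM !mulg1.
split=> [//|x y fx fy|x fx]; rewrite /fixed_sub /=; first by rewrite aut_mulM fx fy.
by apply: (mulgI (f x)); rewrite -aut_mulM mulgV f1 fx mulgV.
Qed.

(** * Fixed subgroups as centralisers in E *)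

Section Fixed.
Variable n : nat.
Hypothesis n_ge2 : (2 <= n)%N.
Let n_gt0 : (0 < n)%N. Proof. exact: ltnW. Qed.
Let m_gt1 : (1 < n.*2)%N. Proof. lia. Qed.
Let m_even : ~~ odd n.*2. Proof. by rewrite odd_double. Qed.
Notation A := (artin n).
Notation emb := (@emb n).
Notation ext := (ext n.*2).
Implicit Types (psi : aut A) (x u g : A) (y z : ext).

Definition models psi y := forall x, emb (psi x) = y * emb x * y^-1.

Lemma models_mul p q y z : models p y -> models q z -> models (p * q) (y * z).
Proof. by move=> py qz x; rewrite aut_mulE py qz invgM !mulgA. Qed.

Lemma models_inner g : models (inner g) (emb g).
Proof. by move=> x; rewrite /= /inner_fun !(embM n_gt0) (embV n_gt0). Qed.

Lemma models_exp psi y k : models psi y -> models (psi ^+ k) (y ^+ k).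
Proof.
move=> py; elim: k => [|k IH]; last by rewrite !expgS; apply: models_mul.
by move=> x; rewrite invg1 mulg1 mul1g.
Qed.

Lemma fixed_subP psi y x : models psi y -> fixed_sub psi x <-> commute (emb x) y.
Proof.
move=> py; rewrite /fixed_sub /=; split=> [px|xy].
  by rewrite /commute -{1}px py mulgVK.
by apply: (emb_inj n_gt0); rewrite py -xy mulgK.
Qed.

Lemma models_eq1 psi y : models psi y -> (forall x, commute (emb x) y) -> psi = 1.
Proof. by move=> py yC; apply: aut_eq => x; apply/(fixed_subP x py). Qed.

Lemma finite_order_elliptic psi y : models psi y -> finite_order psi -> exists c, elliptic c y.
Proof.
move=> py [k [k_gt0 psik]]; case: (cyclic_reduction y) => // hyp.
have [|h he []] := hyperbolic_infinite m_gt1 _ hyp k_gt0; first by lia.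
have [x <-] := emb_surj n_gt0 he; apply: commute_sym.
by apply/(fixed_subP x (models_exp k py)); rewrite psik.
Qed.

(** If [y] were elliptic, its power of exponent 4n would be a turn by a multiple of 2n, which
    centralises the image of [emb]. *)
Lemma infinite_order_hyperbolic psi y : models psi y -> ~ finite_order psi -> hyperbolic y.
Proof.
move=> py psi_inf; case: (cyclic_reduction y) => // -[c] /(elliptic_finite m_gt1) [k mk yk].
case: psi_inf; exists (2 * n.*2)%N; split; first by lia.
apply: (models_eq1 (models_exp _ py)) => x; rewrite yk; apply: commute_sym.
by apply: turn_dvd_commute => //; case: (even_plus_emb n_gt0 x).
Qed.

Lemma emb_Delta_zpow i : emb (zpow (Delta n) i) = turn n.*2 (i * n.*2)%R.
Proof. by rewrite (zpow_morph (embM n_gt0)) (emb_Delta n_gt0) zpow_turn. Qed.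

Lemma turn_Delta x k : (n.*2 %| k)%Z -> emb x = turn _ k -> exists i, x = zpow (Delta n) i.
Proof.
case/dvdzP=> i -> xk; exists i; apply: (emb_inj n_gt0).
by rewrite emb_Delta_zpow.
Qed.

Lemma Delta_inf i : zpow (Delta n) i = 1 -> i = 0%R.
Proof.
move/(congr1 emb); rewrite emb_Delta_zpow (emb1 n_gt0) => /(congr1 (@ext_k _)) /=.
by move/eqP; rewrite GRing.mulf_eq0 => /orP[/eqP//|]; lia.
Qed.

Lemma commute_Delta x : commute x (Delta n).
Proof.
apply: (emb_inj n_gt0); rewrite !(embM n_gt0) (emb_Delta n_gt0).
apply/commute_sym/turn_dvd_commute; rewrite ?dvdzz //.
by case: (even_plus_emb n_gt0 x).
Qed.

Lemma fixed_Delta psi y : models psi y -> ext_e y = false -> fixed_sub psi (Delta n).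
Proof.
move=> py ye; apply/(fixed_subP _ py); rewrite (emb_Delta n_gt0).
by apply: turn_dvd_commute; rewrite ?dvdzz.
Qed.

(** * Automorphisms of infinite order *)

Section Hyperbolic.
Variables (psi : aut A) (y : ext) (u : A) (N : nat).
Hypotheses (py : models psi y) (yH : hyperbolic y) (N_gt0 : (0 < N)%N)
  (uE : emb u = y ^+ N).

Let Ku : fixed_sub psi u.
Proof. by apply/(fixed_subP _ py); rewrite uE; apply/commute_sym/commuteX. Qed.

Lemma hyperbolic_plus : ext_e y = false ->
  [/\ iso_to (int * int)%type (fixed_sub psi),
      is_direct (cyclic_sub u) (cyclic_sub (Delta n)) &
      finite_index (set_prod (cyclic_sub u) (cyclic_sub (Delta n))) (fixed_sub psi)].
Proof.
move=> ye; have [l [lM l0 lD lN]] := hyperbolic_length m_gt1 yH.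
have sK := fixed_sub_subgroup psi.
have KP x : fixed_sub psi x -> commute (emb x) y by move/(fixed_subP x py).
have lM' x x' : fixed_sub psi x -> fixed_sub psi x' ->
    l (emb (x * x')) = (l (emb x) + l (emb x'))%R.
  by move=> /KP ? /KP ?; rewrite (embM n_gt0) lM.
have l0' x : fixed_sub psi x -> l (emb x) = 0%R -> exists i, x = zpow (Delta n) i.
  move=> /KP xy xl; have [k mk] := l0 _ xy (proj1 (even_plus_emb n_gt0 x)) xl.
  exact: turn_Delta.
have lu : l (emb u) <> 0%R by rewrite uE; apply: lN.
have lz : l (emb (Delta n)) = 0%R.
  by rewrite (emb_Delta n_gt0) lD ?dvdzz.
have Kz := fixed_Delta py ye.
have zC x : fixed_sub psi x -> commute x (Delta n) by move=> _; apply: commute_Delta.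
split.
- exact: (length_iso_int2 sK lM' l0' Delta_inf zC Kz lz Ku lu).
- exact: (length_direct sK lM' zC Kz lz Ku lu).
- exact: (length_finite_index2 sK lM' l0' zC Kz lz Ku lu).
Qed.

(** A fixed element of length 0 is a turn; as [y] inverts turns, it is trivial, so the length is
    injective. *)
Lemma hyperbolic_minus : ext_e y = true ->
  iso_to int (fixed_sub psi) /\ finite_index (cyclic_sub u) (fixed_sub psi).
Proof.
move=> ye; have [l [lM l0 _ lN]] := hyperbolic_length m_gt1 yH.
have sK := fixed_sub_subgroup psi.
have KP x : fixed_sub psi x -> commute (emb x) y by move/(fixed_subP x py).
have lM' x x' : fixed_sub psi x -> fixed_sub psi x' ->
    l (emb (x * x')) = (l (emb x) + l (emb x'))%R.
  by move=> /KP ? /KP ?; rewrite (embM n_gt0) lM.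
have l0' x : fixed_sub psi x -> l (emb x) = 0%R -> x = 1.
  move=> /KP xy xl; have [xe _] := even_plus_emb n_gt0 x.
  have [k _ xk] := l0 _ xy xe xl; apply: (emb_inj n_gt0).
  by have := commute_flip_k ye xe xy; rewrite (emb1 n_gt0) xk /= => ->.
have lu : l (emb u) <> 0%R by rewrite uE; apply: lN.
split; first exact: (length_inj_iso_int sK lM' l0' Ku lu).
exact: (length_inj_finite_index sK lM' l0' Ku lu).
Qed.

End Hyperbolic.

(** * Automorphisms of finite order and explicit generators *)

Lemma ext_k_conj (c z : ext) : ext_e c = false -> ext_e z = false ->
  ext_k (c^-1 * z * c) = ext_k z.
Proof. by move=> ce ze; rewrite !ext_kM !ext_eM /= ce ze /=; lia. Qed.

(** After conjugation every fixed element is a turn, so [ext_k] is an injective additive length. *)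
Lemma fixed_on_axis psi y c u : models psi y ->
  (forall x, fixed_sub psi x -> ext_w ((cox_ext c)^-1 * emb x * cox_ext c) = 1) ->
  fixed_sub psi u -> ext_k (emb u) <> 0%R ->
  iso_to int (fixed_sub psi) /\ finite_index (cyclic_sub u) (fixed_sub psi).
Proof.
move=> py Kw Ku ku; have sK := fixed_sub_subgroup psi.
have e0 x : ext_e (emb x) = false by case: (even_plus_emb n_gt0 x).
have lM x x' : fixed_sub psi x -> fixed_sub psi x' ->
    ext_k (emb (x * x')) = (ext_k (emb x) + ext_k (emb x'))%R.
  by move=> _ _; rewrite (embM n_gt0) ext_kM e0.
have l0 x : fixed_sub psi x -> ext_k (emb x) = 0%R -> x = 1.
  move=> /Kw xw xk; apply: (emb_inj n_gt0); rewrite (emb1 n_gt0).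
  apply: (mulgI (cox_ext c)^-1); apply: (mulIg (cox_ext c)); rewrite mulg1 mulVg.
  by apply: ext_eq; rewrite ?xw // ?ext_k_conj // !ext_eM ext_eV e0.
split; first exact: (length_inj_iso_int sK lM l0 Ku ku).
exact: (length_inj_finite_index sK lM l0 Ku ku).
Qed.

Lemma parity_conj (c z : ext) : parity (c^-1 * z * c) = parity z.
Proof. by rewrite !parityM parityV; case: (parity c) (parity z) => [] []. Qed.

Lemma ext_e_conj (c z : ext) : ext_e (c^-1 * z * c) = ext_e z.
Proof. by rewrite !ext_eM ext_eV; case: (ext_e c) (ext_e z) => [] []. Qed.

Lemma even_plus_conjV (c z : ext) : even_plus z -> even_plus (c^-1 * z * c).
Proof. by case=> ze zp; split; rewrite ?ext_e_conj ?parity_conj. Qed.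

(** Even parity of [emb g] rules out the single-letter form, so [emb g] is conjugate to a turn. The
    turn is not by a multiple of 2n, as [inner g] is nontrivial, so only turns commute with it. *)
Lemma fixed_inner_finite g : inner g <> 1 -> finite_order (inner g) ->
  [/\ iso_to int (fixed_sub (inner g)),
      finite_index (cyclic_sub g) (fixed_sub (inner g)) &
      finite_index (cyclic_sub (Delta n)) (fixed_sub (inner g))].
Proof.
move=> g_neq1 /(finite_order_elliptic (models_inner g)) [c]; have py := models_inner g.
have [ge gp] := even_plus_emb n_gt0 g.
case=> [hw|[x hw hx]]; last first.
  by have := elliptic_refl_parity m_gt1 m_even hw hx; rewrite parity_conj gp.
have he : ext_e ((cox_ext c)^-1 * emb g * cox_ext c) = false by rewrite ext_e_conj.
have hk := ext_k_conj (erefl : ext_e (cox_ext c) = false) ge.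
have mk : ~ (n.*2 %| ext_k (emb g))%Z.
  move=> mk; apply: g_neq1; apply: (models_eq1 py) => x; apply: commute_sym.
  have -> : emb g = turn _ (ext_k (emb g)).
    apply: (mulgI (cox_ext c)^-1); apply: (mulIg (cox_ext c)).
    by rewrite conjV_turn //; apply: ext_eq; rewrite ?hw ?hk ?he.
  by apply: turn_dvd_commute => //; case: (even_plus_emb n_gt0 x).
have Kw x : fixed_sub (inner g) x -> ext_w ((cox_ext c)^-1 * emb x * cox_ext c) = 1.
  move/(fixed_subP x py)/(commute_conjV (cox_ext c)); apply: commute_turn => //.
    by rewrite hk.
  by rewrite ext_e_conj; case: (even_plus_emb n_gt0 x).
have gk : ext_k (emb g) <> 0%R by move=> k0; apply: mk; rewrite k0.
have Kg : fixed_sub (inner g) g by apply/(fixed_subP _ py).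
have [isoK fig] := fixed_on_axis py Kw Kg gk; split=> //.
have [] // := fixed_on_axis py Kw (fixed_Delta py ge) _.
by rewrite (emb_Delta n_gt0) /=; lia.
Qed.

Lemma models_sigma : models (art_sigma n) (sh n).
Proof. by move=> x; rewrite (emb_sigma n_gt0). Qed.

Lemma models_iota : models (art_iota n) (sh n * flip n).
Proof. by move=> x; rewrite (emb_iota n_gt0). Qed.

Lemma models_sigma_iota : models (art_sigma n * art_iota n) (flip n).
Proof.
have := models_mul models_sigma models_iota.
by rewrite mulgA sh2 mul1g.
Qed.

(** For an involution [z] this exhibits the square of the conjugating element [emb g * z] as an
    element of the Artin group. *)
Lemma emb_square psi z g : models psi z -> z * z = 1 -> emb (g * psi g) = (emb g * z) ^+ 2.
Proof.
move=> pz z2; have zV : z^-1 = z by apply: (mulgI z); rewrite mulgV z2.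
by rewrite (embM n_gt0) pz zV expg2 !mulgA.
Qed.

Lemma fixed_refl_Delta psi y c (r : 'Z_(n.*2)) : models psi y ->
  ext_w ((cox_ext c)^-1 * y * cox_ext c) = refl r ->
  aff ((cox_ext c)^-1 * y * cox_ext c) r = r ->
  forall u, fixed_sub psi u -> exists i, u = zpow (Delta n) i.
Proof.
move=> py hw hx u /(fixed_subP u py)/(commute_conjV (cox_ext c)).
case/(commute_refl_conj m_gt1 m_even hw hx) => [|k mk E].
  exact/even_plus_conjV/even_plus_emb.
apply: (turn_Delta mk); apply: (mulgI (cox_ext c)^-1); apply: (mulIg (cox_ext c)).
by rewrite E conjV_turn.
Qed.

(** Here [y] is odd of sign -. With empty word, its integer part is odd and nothing else commutes
    with it; with one letter, fixed elements are powers of [Delta n], which [y] inverts. *)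
Lemma fixed_iota_finite g : finite_order (inner g * art_iota n) ->
  fixed_sub (inner g * art_iota n) = [set 1].
Proof.
have py := models_mul (models_inner g) models_iota.
have [ge gp] := even_plus_emb n_gt0 g.
set y := emb g * _ in py.
have ye : ext_e y by rewrite ext_eM ge.
have yp : parity y by rewrite parityM gp.
move=> /(finite_order_elliptic py) [c H]; apply/seteqP; split=> [x Kx|_ ->]; last first.
  by case: (fixed_sub_subgroup (inner g * art_iota n)).
have xy := (proj1 (fixed_subP x py) Kx).
have [xe _] := even_plus_emb n_gt0 x.
case: H => [hw|[r hw hr]].
  have hp : parity ((cox_ext c)^-1 * y * cox_ext c) by rewrite parity_conj.
  rewrite /parity hw /= in hp.
  have /(commute_conjV (cox_ext c)) := xy.
  move/(commute_flip_odd m_gt1 m_even hw _ hp); rewrite !ext_e_conj => /(_ ye xe) E.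
  apply: (emb_inj n_gt0); rewrite (emb1 n_gt0).
  by apply: (mulgI (cox_ext c)^-1); apply: (mulIg (cox_ext c)); rewrite E mulg1 mulVg.
have [i xi] := fixed_refl_Delta py hw hr Kx.
have := commute_flip_k ye xe xy; rewrite xi emb_Delta_zpow /= => /eqP.
by rewrite GRing.mulf_eq0 => /orP[/eqP->//|]; lia.
Qed.

(** Here [y] is odd of sign +. With empty word it is a turn by an odd integer, not divisible by 2n;
    with one letter, only powers of [Delta n] are fixed. *)
Lemma fixed_sigma_finite g : finite_order (inner g * art_sigma n) ->
  iso_to int (fixed_sub (inner g * art_sigma n)).
Proof.
have py := models_mul (models_inner g) models_sigma.
have [ge gp] := even_plus_emb n_gt0 g.
set y := emb g * _ in py.
have ye : ext_e y = false by rewrite ext_eM ge.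
have yp : parity y by rewrite parityM gp.
move=> /(finite_order_elliptic py) [c H].
have KD := fixed_Delta py ye.
have Dk : ext_k (emb (Delta n)) <> 0%R by rewrite (emb_Delta n_gt0) /=; lia.
suff Kw x : fixed_sub (inner g * art_sigma n) x ->
    ext_w ((cox_ext c)^-1 * emb x * cox_ext c) = 1.
  by case: (fixed_on_axis py Kw KD Dk).
case: H => [hw|[r hw hr]] Kx; last first.
  have [i ->] := fixed_refl_Delta py hw hr Kx.
  by rewrite emb_Delta_zpow conjV_turn //; apply/dvdzP; exists i.
have /(commute_conjV (cox_ext c)) := proj1 (fixed_subP x py) Kx.
apply: commute_turn; rewrite ?ext_e_conj //; last by case: (even_plus_emb n_gt0 x).
move=> /(dvd_even m_even) hk.
have : parity ((cox_ext c)^-1 * y * cox_ext c) by rewrite parity_conj.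
by rewrite /parity hw hk.
Qed.

Lemma fixed_sigma : fixed_sub (art_sigma n) = cyclic_sub (Delta n).
Proof.
rewrite cyclic_subE; apply/seteqP; split=> [x Kx|_ [i _ <-]]; last first.
  apply: (@subgroup_zpow _ (fixed_sub _)); first exact: fixed_sub_subgroup.
  exact: (fixed_Delta models_sigma).
have [||i ->] := @fixed_refl_Delta _ _ 1 0%R models_sigma _ _ _ Kx; last by exists i.
  by rewrite cox_ext1 invg1 mul1g mulg1.
by rewrite cox_ext1 invg1 mul1g mulg1 /aff /= GRing.addr0.
Qed.

Let t : ext := cox_ext (half_turn_word n).

Lemma even_plus_t : even_plus t.
Proof. by split; rewrite // /parity /t /half_turn_word odd_size_mul. Qed.

(** Commuting with the flip kills the integer part and makes every letter equal to its negative. *)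
Lemma commute_flipP y : even_plus y -> commute y (flip n) <-> exists i, y = zpow t i.
Proof.
have tfl : commute (flip n) t.
  apply: ext_eq => //; rewrite !ext_wM /act /= mul1g mulg1.
  rewrite wmapM !wmap_refl /aff /= GRing.oppr0 !GRing.add0r oppr_mid //.
move=> [ye yp]; split=> [yf|[i ->]]; last exact/commute_sym/commute_zpow.
have yk := @commute_flip_k _ (flip n) y erefl ye yf.
have wE : wmap (aff (flip n)) (ext_w y) = ext_w y.
  by move/(congr1 (@ext_w _)): yf; rewrite !ext_wM /act /= mulg1 mul1g.
have [|//|i wi] := @half_turn_word_gen n n_gt0 (ext_w y).
- move=> x xw; move/(congr1 (@cox_seq _)): wE; rewrite wmap_seq; last exact: aff_inj.
  case/(nthP x): xw => j jw jx /(congr1 (fun s => nth x s j)).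
  by rewrite (nth_map x) // jx /aff /= GRing.add0r.
- by move: yp; rewrite /parity yk addbF => ->.
exists i; rewrite -(zpow_morph (@cox_extM _)) -wi.
exact: ext_eq.
Qed.

Lemma fixed_flip_conj psi z u : models psi (z * flip n * z^-1) -> emb u = z * t * z^-1 ->
  fixed_sub psi = cyclic_sub u /\ iso_to int (fixed_sub psi).
Proof.
move=> py uE.
have cM : {morph (fun v => z * v * z^-1) : v w / v * w}.
  by move=> v w; rewrite !mulgA mulgVK.
have ui i : emb (zpow u i) = z * zpow t i * z^-1.
  by rewrite (zpow_morph (embM n_gt0)) uE -(zpow_morph cM).
have KE : fixed_sub psi = cyclic_sub u.
  rewrite cyclic_subE; apply/seteqP; split=> [x /(fixed_subP x py) xy|_ [i _ <-]].
    have : commute (z^-1 * emb x * z) (flip n).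
      by have := commute_conjV z xy; rewrite !mulgA mulgVK mulVg mul1g.
    case/commute_flipP => [|i zi]; first exact/even_plus_conjV/even_plus_emb.
    by exists i => //; apply: (emb_inj n_gt0); rewrite ui -zi !mulgA mulgV mul1g mulgK.
  apply/(fixed_subP _ py); rewrite ui /commute -!cM; congr (_ * _ * _).
  apply/commute_flipP; last by exists i.
  rewrite -[zpow t i](mulKg z) -[z * _](mulgK z^-1) invgK -ui mulgA.
  exact/even_plus_conjV/even_plus_emb.
split=> //; rewrite KE; apply: iso_to_cyclic_sub => i /(congr1 emb).
rewrite ui (emb1 n_gt0) => E; apply: (half_turn_word_inf n_gt0).
have : zpow t i = 1 by rewrite -[zpow t i](mulKg z) -[z * _](mulgK z^-1) E invgK mul1g mulVg.
by rewrite -(zpow_morph (@cox_extM _)) => /(congr1 (@ext_w _)).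
Qed.

(** Here [y] is even of sign -, so its reduced form has empty word and even integer part 2k; this
    form is the conjugate of the flip by the turn by k. *)
Lemma fixed_sigma_iota_finite g : finite_order (inner g * (art_sigma n * art_iota n)) ->
  iso_to int (fixed_sub (inner g * (art_sigma n * art_iota n))).
Proof.
have py := models_mul (models_inner g) models_sigma_iota.
have [ge gp] := even_plus_emb n_gt0 g.
set y := emb g * _ in py.
have ye : ext_e y by rewrite ext_eM ge.
have yp : parity y = false by rewrite parityM gp.
move=> /(finite_order_elliptic py) [c]; case=> [hw|[r hw hr]]; last first.
  by have := elliptic_refl_parity m_gt1 m_even hw hr; rewrite parity_conj yp.
set h := _ * y * _ in hw.
have [k hk] : exists k, ext_k h = (k + k)%R.
  have hk : parity h = false by rewrite parity_conj.
  rewrite /parity hw /= -/h in hk.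
  have /dvdzP[q qE] : (2 %| ext_k h)%Z by rewrite dvdzE dvdn2 hk.
  by exists q; rewrite qE; lia.
pose z := cox_ext c * turn _ k.
have hE : h = turn _ k * flip n * (turn _ k)^-1.
  by apply: ext_eq; rewrite ?hw ?ext_e_conj ?ye // hk /=; lia.
have yE : y = z * flip n * z^-1.
  have -> : y = cox_ext c * h * (cox_ext c)^-1 by rewrite /h !mulgA mulgV mul1g mulgK.
  by rewrite hE /z invgM !mulgA.
have [u uE] : exists u, emb u = z * t * z^-1 by apply/(emb_surj n_gt0)/even_plus_conj/even_plus_t.
by rewrite yE in py; case: (fixed_flip_conj py uE).
Qed.

Lemma turn_sh_turn (x : 'Z_(n.*2)) k : (k%:~R)%R = x ->
  turn _ k * sh n * (turn _ k)^-1 = cox_ext (refl x).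
Proof.
move=> <-; apply: ext_eq => [||//]; last by rewrite /=; lia.
have -> : ext_w (turn n.*2 k * sh n * (turn n.*2 k)^-1) = act (turn _ k) (act (sh n) 1).
  by rewrite -actM.
by rewrite /act !wmap1 mulg1 wmap_refl mul1g /aff /= GRing.addr0.
Qed.

Lemma st_mid : st n ^+ n * sh n * (st n ^+ n)^-1 = cox_ext (refl (mid n)).
Proof. by rewrite st_exp; apply: turn_sh_turn. Qed.

Lemma emb_ba_exp k : emb ((art_b n * art_a n) ^+ k) = sh n * st n ^+ (2 * k) * sh n.
Proof.
rewrite (embX n_gt0) (emb_ba n_gt0) expgnA.
have -> : sh n * st n ^+ 2 * sh n = (sh n)^-1 * st n ^+ 2 * sh n by rewrite shV.
by rewrite -conjV_exp shV.
Qed.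

Lemma emb_ab_exp k : emb ((art_a n * art_b n) ^+ k) = st n ^+ (2 * k).
Proof. by rewrite (embX n_gt0) (emb_ab n_gt0) expgnA. Qed.

Lemma fixed_sigma_iota_gen u : emb u = t ->
  fixed_sub (art_sigma n * art_iota n) = cyclic_sub u.
Proof.
move=> uE; apply: (proj1 (@fixed_flip_conj _ 1 u _ _)).
  by rewrite mul1g invg1 mulg1; apply: models_sigma_iota.
by rewrite mul1g invg1 mulg1.
Qed.

(** The displayed generator maps to st^n sh st^(-n) sh = s_n s_0, the inverse of [t]. *)
Lemma fixed_sigma_iota_even : ~~ odd n -> fixed_sub (art_sigma n * art_iota n) =
  cyclic_sub ((art_a n * art_b n) ^+ (n %/ 2) * (art_b n * art_a n) ^- (n %/ 2)).
Proof.
move=> n_even; rewrite -[RHS]cyclic_subV; apply: fixed_sigma_iota_gen.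
have n2 : (2 * (n %/ 2) = n)%N by rewrite mulnC divnK // dvdn2.
rewrite (embV n_gt0) (embM n_gt0) (embV n_gt0) emb_ab_exp emb_ba_exp n2.
by rewrite invgM invgK -!mulgA (mulgA (st n ^+ n)) st_mid -cox_extM.
Qed.

(** With n = 2k + 1 the generator maps to sh st^n sh st^(-n) = s_0 s_n, which is [t]. *)
Lemma fixed_sigma_iota_odd : odd n -> fixed_sub (art_sigma n * art_iota n) =
  cyclic_sub (art_b n * (art_a n * art_b n) ^+ ((n - 1) %/ 2)
              * (art_b n * art_a n) ^- ((n - 1) %/ 2) * (art_a n)^-1).
Proof.
move=> n_odd; apply: fixed_sigma_iota_gen.
set k := ((n - 1) %/ 2)%N.
have nk : (n = (2 * k).+1)%N.
  by rewrite /k mulnC divnK ?dvdn2 ?oddB ?n_odd //; lia.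
rewrite !(embM n_gt0) !(embV n_gt0) emb_ab_exp emb_ba_exp (emb_a n_gt0) (emb_b n_gt0).
rewrite !invgM shV -!mulgA (mulgA (sh n) (sh n)) sh2 mul1g.
rewrite -invgM -expgS (mulgA (st n)) -expgS -nk.
by rewrite /t cox_extM -st_mid !mulgA.
Qed.

End Fixed.

(* In the first item the inner automorphism is assumed nontrivial: for g
   central it is the identity, which has order 1 and fixes the whole group. *)
Theorem theorem3p7 (n : nat) (n_ge2 : (2 <= n)%N) :
  (* the automorphisms considered below exhaust Aut_Gamma *)
  (forall gamma : aut (artin n), AutGamma n gamma ->
     exists g : artin n,
       [\/ gamma = inner g, gamma = inner g * art_iota n,
           gamma = inner g * art_sigma n | gamma = inner g * (art_sigma n * art_iota n)]) /\
  (* 1 *)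
  (forall g : artin n, inner g <> 1 -> finite_order (inner g) ->
     [/\ iso_to int (fixed_sub (inner g)),
         finite_index (cyclic_sub g) (fixed_sub (inner g)) &
         finite_index (cyclic_sub (Delta n)) (fixed_sub (inner g))]) /\
  (* 2 *)
  (forall g : artin n, ~ finite_order (inner g) ->
     [/\ iso_to (int * int)%type (fixed_sub (inner g)),
         is_direct (cyclic_sub g) (cyclic_sub (Delta n)) &
         finite_index (set_prod (cyclic_sub g) (cyclic_sub (Delta n)))
                      (fixed_sub (inner g))]) /\
  (* 3 *)
  (forall g : artin n, finite_order (inner g * art_iota n) ->
     fixed_sub (inner g * art_iota n) = [set 1]) /\
  (* 4 *)
  (forall g : artin n, ~ finite_order (inner g * art_iota n) ->
     iso_to int (fixed_sub (inner g * art_iota n)) /\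
     finite_index (cyclic_sub (g * art_iota n g))
                  (fixed_sub (inner g * art_iota n))) /\
  (* 5 *)
  ((forall g : artin n, finite_order (inner g * art_sigma n) ->
      iso_to int (fixed_sub (inner g * art_sigma n))) /\
   fixed_sub (art_sigma n) = cyclic_sub (Delta n)) /\
  (* 6 *)
  (forall g : artin n, ~ finite_order (inner g * art_sigma n) ->
     [/\ iso_to (int * int)%type (fixed_sub (inner g * art_sigma n)),
         is_direct (cyclic_sub (g * art_sigma n g)) (cyclic_sub (Delta n)) &
         finite_index
           (set_prod (cyclic_sub (g * art_sigma n g)) (cyclic_sub (Delta n)))
           (fixed_sub (inner g * art_sigma n))]) /\
  (* 7 *)
  ((forall g : artin n, finite_order (inner g * (art_sigma n * art_iota n)) ->
      iso_to int (fixed_sub (inner g * (art_sigma n * art_iota n)))) /\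
   (~~ odd n ->
      fixed_sub (art_sigma n * art_iota n) =
      cyclic_sub ((art_a n * art_b n) ^+ (n %/ 2)
                  * (art_b n * art_a n) ^- (n %/ 2))) /\
   (odd n ->
      fixed_sub (art_sigma n * art_iota n) =
      cyclic_sub (art_b n * (art_a n * art_b n) ^+ ((n - 1) %/ 2)
                  * (art_b n * art_a n) ^- ((n - 1) %/ 2)
                  * (art_a n)^-1))) /\
  (* 8 *)
  (forall g : artin n, ~ finite_order (inner g * (art_sigma n * art_iota n)) ->
     iso_to int (fixed_sub (inner g * (art_sigma n * art_iota n))) /\
     finite_index (cyclic_sub (g * (art_sigma n * art_iota n) g))
                  (fixed_sub (inner g * (art_sigma n * art_iota n)))).
Proof.
have sh_fl2 : (sh n * flip n) * (sh n * flip n) = 1.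
  by rewrite -mulgA (mulgA (flip n)) fl_sh -mulgA fl2 mulg1 sh2.
have mi := models_inner n_ge2.
have e0 (g : artin n) : ext_e (emb g) = false by case: (even_plus_emb (ltnW n_ge2) g).
split; first exact: AutGamma_form.
split; first exact: fixed_inner_finite.
split.
  move=> g g_inf; have yH := infinite_order_hyperbolic n_ge2 (mi g) g_inf.
  (* Inner automorphisms use the first power of [emb g]; the other three families use the square
     given by [emb_square]. *)
  exact: (hyperbolic_plus n_ge2 (mi g) yH (ltn0Sn 0)).
split; first exact: fixed_iota_finite.
split.
  move=> g g_inf; have py := models_mul (mi g) (models_iota n_ge2).
  have yH := infinite_order_hyperbolic n_ge2 py g_inf.
  apply: (hyperbolic_minus n_ge2 py yH (ltn0Sn 1)); last by rewrite ext_eM e0.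
  exact: (emb_square n_ge2 g (models_iota n_ge2) sh_fl2).
split.
  by split; [exact: fixed_sigma_finite | exact: fixed_sigma].
split.
  move=> g g_inf; have py := models_mul (mi g) (models_sigma n_ge2).
  have yH := infinite_order_hyperbolic n_ge2 py g_inf.
  apply: (hyperbolic_plus n_ge2 py yH (ltn0Sn 1)); last by rewrite ext_eM e0.
  exact: (emb_square n_ge2 g (models_sigma n_ge2) (sh2 n)).
split.
  split; first exact: fixed_sigma_iota_finite.
  by split; [exact: fixed_sigma_iota_even | exact: fixed_sigma_iota_odd].
move=> g g_inf; have py := models_mul (mi g) (models_sigma_iota n_ge2).
have yH := infinite_order_hyperbolic n_ge2 py g_inf.
apply: (hyperbolic_minus n_ge2 py yH (ltn0Sn 1)); last by rewrite ext_eM e0.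
exact: (emb_square n_ge2 g (models_sigma_iota n_ge2) (fl2 n)).
Qed.
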